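(* Let $n\ge1$, $t\in(0,1)$, $\hbar>0$ and $q_t=-\frac1\hbar\log(1-t)$. With $\mathcal G_F^{bs}(P_n(t),\pi_t)$ and $\mathfrak F_{n-1}$ the topological groupoids defined in the context, the map $\Phi:\mathcal G_F^{bs}(P_n(t),\pi_t)\to\mathfrak F_{n-1}$, $$\Phi(c,h)=(-p_n;\ p_1,p_2-p_1,\dots,p_{n-1}-p_{n-2};\ q_1-q_t,q_2-q_1,\dots,q_{n-1}-q_{n-2})^\sim,$$ where $h_k=\hbar p_k$ and $c_k=1-t-e^{-\hbar q_k}$ for $k<n$ (and $h_n=\hbar p_n$), is an isomorphism of topological groupoids.
   Context: Let $\overline{\mathbb Z}=\mathbb Z\cup\{\infty\}$ be the one-point compactification of $\mathbb Z$ and $\overline{\mathbb N}=\mathbb N\cup\{\infty\}\subset\overline{\mathbb Z}$ ($0\in\mathbb N$); $e^{-\hbar\infty}=0$. **$\mathcal G_F^{bs}(P_n(t),\pi_t)$** (groupoid of Bohr-Sommerfeld leaves of the Poisson submanifold $P_n(t)\cong\mathbb S^{2n-1}$ of $(\mathbb{CP}_n,\pi_t)$, where $\pi_t$ is the non standard $SU(n+1)$-covariant Poisson structure with parameter $t$): let $\Delta_n=\{c\in\mathbb R^n:0\le c_1\le\dots\le c_n\le1\}$ and $r(c,h)_i=1-t+e^{-h_i}(c_i+t-1)$. It is the set of $(c,h)\in\mathbb R^n\times\mathbb R^n$ with $c\in\Delta_n$, $r(c,h)\in\Delta_n$, $c_n=1-t$, $h_i\in\hbar\mathbb Z$ for all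 $i$, $\log|c_i-1+t|\in\hbar\mathbb Z$ whenever $c_i\neq1-t$, and $h_i=h_{i+1}$ whenever $c_i=c_{i+1}=1-t$. (Since $c_n=1-t$, all $c_i\le1-t$.) Source $c$, target $r(c,h)$, product $(c,h)(r(c,h),h')=(c,h+h')$, subspace topology. **$\mathfrak F_{n-1}$** (Sheu's groupoid for the quantum sphere $\mathbb S_q^{2n-1}$): let $\mathbb Z\times\mathbb Z^{n-1}$ act on $\overline{\mathbb Z}^{n-1}$, the first factor trivially and the second by translation (trivially on infinite coordinates). Elements of the action groupoid restricted to $\overline{\mathbb N}^{n-1}$ are $(z;x;w)$ with $z\in\mathbb Z$, $x\in\mathbb Z^{n-1}$, $w,w+x\in\overline{\mathbb N}^{n-1}$, source $w$, target $w+x$, product $(z;x;w)(z';x';w+x)=(z+z';x+x';w)$. Let $\mathcal F_{n-1}$ be the subgroupoid of those $(z;x;w)$ such that $w_i=\infty$ implies $z=-\sum_jx_j$ and $x_k=0$ for all $k>i$. Let $\mathfrak F_{n-1}=\mathcal F_{n-1}/\sim$ (quotient topology, induced groupoid structure), where $(z;x;w)\sim(z;x;w_1,\dots,w_i,\infty,\dots,\infty)$ if $w_i=\infty$; $(z;x;w)^\sim$ denotes the class. For $n=1$ the entries $x,w$ are absent. In the formula for $\Phi$, if $i$ is the first index with $q_i=\infty$, the entries $q_l-q_{l-1}=\infty-\infty$ with $l>i$ may be given any value, since they do not affect the class.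
   Formalization: In the formula for Φ, q_t is replaced by its ceiling ⌈q_t⌉: for n ≥ 2 the entry q_1 − q_t lies in the integers with infinity only when q_t is an integer, in which case nothing changes. *)

(* Defs.v *)
From HB Require Import structures.
From Stdlib Require Import Relations.
From mathcomp Require Import all_boot all_order all_algebra generic_quotient.
From mathcomp Require Import all_classical all_reals all_analysis.
From mathcomp Require Import ring zify.

Set Implicit Arguments.
Unset Strict Implicit.
Unset Printing Implicit Defensive.

Import Order.TTheory GRing.Theory Num.Theory.
Import numFieldNormedType.Exports.

Local Open Scope classical_set_scope.
Local Open Scope ring_scope.

(* The product is given by its graph: gmul a b c says that the product ab is
   defined and equal to c. Arrows compose from left to right, so that ab is
   defined when the target of a is the source of b. The last field says that
   the product is continuous on the space of composable pairs. *)
Record topGroupoid := TopGroupoid {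
  gobj : topologicalType;
  garr : topologicalType;
  gsrc : garr -> gobj;
  gtgt : garr -> gobj;
  gone : gobj -> garr;
  ginv : garr -> garr;
  gmul : garr -> garr -> garr -> Prop;
  gmul_ex : forall a b, (exists c, gmul a b c) <-> gtgt a = gsrc b;
  gmul_uniq : forall a b c c', gmul a b c -> gmul a b c' -> c = c';
  gmul_src : forall a b c, gmul a b c -> gsrc c = gsrc a;
  gmul_tgt : forall a b c, gmul a b c -> gtgt c = gtgt b;
  gmulA : forall a b c ab bc abc,
    gmul a b ab -> gmul b c bc -> gmul ab c abc -> gmul a bc abc;
  gone_src : forall u, gsrc (gone u) = u;
  gone_tgt : forall u, gtgt (gone u) = u;
  gmul1l : forall a, gmul (gone (gsrc a)) a a;
  gmul1r : forall a, gmul a (gone (gtgt a)) a;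
  gmulV : forall a, gmul a (ginv a) (gone (gsrc a));
  gmulVl : forall a, gmul (ginv a) a (gone (gtgt a));
  gsrc_cont : continuous gsrc;
  gtgt_cont : continuous gtgt;
  gone_cont : continuous gone;
  ginv_cont : continuous ginv;
  gmul_cont : forall a b c, gmul a b c -> forall U, nbhs c U ->
    \forall ab \near (a, b), forall d, gmul ab.1 ab.2 d -> U d }.

Definition homeomorphism (S T : topologicalType) (f : S -> T) :=
  continuous f /\ exists g : T -> S, [/\ continuous g, cancel f g & cancel g f].

Definition topGroupoid_iso (G H : topGroupoid) (F : garr G -> garr H) :=
  homeomorphism F /\
  exists F0 : gobj G -> gobj H,
    [/\ homeomorphism F0,
        forall a, gsrc (F a) = F0 (gsrc a),
        forall a, gtgt (F a) = F0 (gtgt a)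
      & forall a b c, gmul a b c -> gmul (F a) (F b) (F c)].

Lemma cont_fst (S T : topologicalType) : continuous (@fst S T).
Proof. by move=> x; exact: cvg_fst. Qed.
Lemma cont_snd (S T : topologicalType) : continuous (@snd S T).
Proof. by move=> x; exact: cvg_snd. Qed.
Lemma cont_comp (S T U : topologicalType) (f : S -> T) (g : T -> U) :
  continuous f -> continuous g -> continuous (fun x => g (f x)).
Proof. by move=> cf cg x; apply: continuous_comp; [exact: cf|exact: cg]. Qed.
Lemma cont_pair (S T U : topologicalType) (f : S -> T) (g : S -> U) :
  continuous f -> continuous g -> continuous (fun x => (f x, g x)).
Proof. by move=> cf cg x; apply: cvg_pair; [exact: cf|exact: cg]. Qed.

Section MatrixCvg.
Lemma cont_mx (S K : topologicalType) m n (f : S -> 'M[K]_(m, n)) :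
  (forall i j, continuous (fun s => f s i j)) -> continuous f.
Proof.
move=> H s A [P MP sPA].
have H1 : \forall x \near s, forall i j, P i j (f x i j).
  by apply: filter_forall => i; apply: filter_forall => j; exact/H/MP.
by apply: filterS H1 => x Hx; apply: sPA.
Qed.

Lemma coord_cont (K : topologicalType) m n i j :
  continuous (fun M : 'M[K]_(m, n) => M i j).
Proof.
move=> M A MA; exists (fun i' j' => if (i' == i) && (j' == j) then A else setT).
  by move=> i' j'; case: ifP => [/andP[/eqP-> /eqP->]//|_]; exact: filterT.
by move=> N /(_ i j); rewrite !eqxx.
Qed.

Lemma cont_mxD (R : realType) (S : topologicalType) m n
    (f g : S -> 'M[R]_(m, n)) :
  continuous f -> continuous g -> continuous (fun s => f s + g s).
Proof.
move=> cf cg; apply: cont_mx => i j s; under eq_fun do rewrite mxE.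
apply: cvgD.
  exact: (cont_comp cf (@coord_cont R m n i j)).
exact: (cont_comp cg (@coord_cont R m n i j)).
Qed.

End MatrixCvg.

Section Subtype.
Context {X : topologicalType} (A : set X).

Lemma val_cont : continuous (val : A -> X).
Proof. exact: (@initial_continuous _ _ set_val). Qed.

Lemma sub_cont (S : topologicalType) (f : S -> A) :
  continuous (fun s => val (f s)) -> continuous f.
Proof.
move=> cf; apply/continuousP => U [V oV <-].
have /continuousP/(_ V oV) := cf; rewrite -comp_preimage; congr open.
Qed.
End Subtype.

(* The Bohr-Sommerfeld groupoid of P_n(t), with n = m.+1; gtarget c h is
   r(c,h). *)
Section BohrSommerfeld.
Context {R : realType}.
Variables (m : nat) (t hbar : R).

Definition Delta n : set 'rV[R]_n :=
  [set c | (forall i, 0 <= c 0 i <= 1) /\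
           (forall i j : 'I_n, (i <= j)%N -> c 0 i <= c 0 j)].

Definition gtarget n (c h : 'rV[R]_n) : 'rV[R]_n :=
  \row_i (1 - t + expR (- h 0 i) * (c 0 i + t - 1)).

Definition hbarZ : set R := [set hbar * k%:~R | k in [set: int]].

Definition BSlog n (c : 'rV[R]_n) :=
  forall i, c 0 i != 1 - t -> hbarZ (ln `|c 0 i - 1 + t|).

Definition bs_obj : set 'rV[R]_m.+1 :=
  [set c | [/\ Delta c, c 0 ord_max = 1 - t & BSlog c]].

Definition bs_arr : set ('rV[R]_m.+1 * 'rV[R]_m.+1) :=
  [set g | let: (c, h) := g in
    [/\ Delta c /\ Delta (gtarget c h),
        c 0 ord_max = 1 - t,
        forall i, hbarZ (h 0 i),
        BSlog c
      & forall i j : 'I_m.+1, j = i.+1 :> nat ->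
          c 0 i = 1 - t -> c 0 j = 1 - t -> h 0 i = h 0 j]].

Lemma hbarZ0 : hbarZ 0. Proof. by exists 0; rewrite ?mulr0. Qed.
Lemma hbarZD x y : hbarZ x -> hbarZ y -> hbarZ (x + y).
Proof. by move=> [a _ <-] [b _ <-]; exists (a + b); rewrite // rmorphD mulrDr. Qed.
Lemma hbarZN x : hbarZ x -> hbarZ (- x).
Proof. by move=> [a _ <-]; exists (- a); rewrite // rmorphN mulrN. Qed.

Lemma gtarget0 n (c : 'rV[R]_n) : gtarget c 0 = c.
Proof. by apply/rowP => i; rewrite !mxE oppr0 expR0; ring. Qed.

Lemma gtargetD n (c h k : 'rV[R]_n) :
  gtarget c (h + k) = gtarget (gtarget c h) k.
Proof. by apply/rowP => i; rewrite !mxE opprD expRD; ring. Qed.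

Lemma gtarget_eq n (c h : 'rV[R]_n) i :
  (gtarget c h 0 i == 1 - t) = (c 0 i == 1 - t).
Proof.
rewrite mxE -subr_eq0 addrAC subrr add0r mulf_eq0 gt_eqF ?expR_gt0//=.
by rewrite -(subr_eq0 (c 0 i)); congr (_ == _); ring.
Qed.

Lemma bs_srcP g : bs_arr g -> bs_obj g.1.
Proof. by case: g => c h [[? _] ? _ ? _]; split. Qed.

Lemma bs_tgtP g : bs_arr g -> bs_obj (gtarget g.1 g.2).
Proof.
case: g => c h [[Dc Dr] cn hZ cZ _]; split => //=.
  by apply/eqP; rewrite gtarget_eq cn.
move=> i; rewrite gtarget_eq => ci.
have ci' : c 0 i - 1 + t != 0.
  by rewrite (_ : _ + t = c 0 i - (1 - t)) ?subr_eq0//; ring.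
have -> : gtarget c h 0 i - 1 + t = expR (- h 0 i) * (c 0 i - 1 + t).
  by rewrite mxE; ring.
rewrite normrM lnM ?posrE ?normr_gt0 ?ci' ?gt_eqF ?expR_gt0//.
rewrite ger0_norm ?expR_ge0// expRK.
by apply: hbarZD; [exact/hbarZN/hZ|exact: cZ].
Qed.

Lemma bs_oneP c : bs_obj c -> bs_arr (c, 0).
Proof.
move=> [Dc cn cZ]; split => //; first by rewrite gtarget0.
  by move=> i; rewrite mxE; exact: hbarZ0.
by move=> i j _ _ _; rewrite !mxE.
Qed.

Lemma bs_invP c h : bs_arr (c, h) -> bs_arr (gtarget c h, - h).
Proof.
move=> ca; have [Dr rn rZ] := bs_tgtP ca.
case: ca => [[Dc _] cn hZ cZ E]; split => //.
- by rewrite -gtargetD subrr gtarget0.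
- by move=> i; rewrite mxE; exact/hbarZN/hZ.
- move=> i j ij /eqP; rewrite gtarget_eq => /eqP ci /eqP.
  by rewrite gtarget_eq => /eqP cj; rewrite !mxE (E i j).
Qed.

Lemma bs_mulP c h k :
  bs_arr (c, h) -> bs_arr (gtarget c h, k) -> bs_arr (c, h + k).
Proof.
move=> [[Dc Dr] cn hZ cZ E] [[_ Dr'] _ kZ _ E']; split => //.
- by rewrite gtargetD.
- by move=> i; rewrite mxE; apply: hbarZD.
- move=> i j ij ci cj; rewrite !mxE (E i j)// (E' i j)//;
  by apply/eqP; rewrite gtarget_eq; apply/eqP.
Qed.

Definition bs_src (g : bs_arr) : bs_obj :=
  exist _ (val g).1 (mem_set (bs_srcP (set_mem (valP g)))).
Definition bs_tgt (g : bs_arr) : bs_obj :=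
  exist _ (gtarget (val g).1 (val g).2) (mem_set (bs_tgtP (set_mem (valP g)))).
Definition bs_one (c : bs_obj) : bs_arr :=
  exist _ (val c, 0) (mem_set (bs_oneP (set_mem (valP c)))).

Definition bs_mul (g g' g'' : bs_arr) :=
  (val g').1 = gtarget (val g).1 (val g).2 /\
  val g'' = ((val g).1, (val g).2 + (val g').2).

Lemma bs_inv_subproof (g : bs_arr) :
  bs_arr (gtarget (val g).1 (val g).2, - (val g).2).
Proof. by apply: bs_invP; case: g => -[c h] H; exact: set_mem H. Qed.
Definition bs_inv (g : bs_arr) : bs_arr :=
  exist _ (gtarget (val g).1 (val g).2, - (val g).2)
    (mem_set (bs_inv_subproof g)).

Lemma bs_mul_ex a b : (exists c, bs_mul a b c) <-> bs_tgt a = bs_src b.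
Proof.
split=> [[c [e _]]|/(congr1 val)/= e]; first by apply/val_inj.
have Ha : bs_arr ((val a).1, (val a).2).
  by rewrite -surjective_pairing; exact: set_mem (valP a).
have Hb : bs_arr (gtarget (val a).1 (val a).2, (val b).2).
  by rewrite e -surjective_pairing; exact: set_mem (valP b).
by exists (exist _ ((val a).1, (val a).2 + (val b).2) (mem_set (bs_mulP Ha Hb))).
Qed.

Lemma bs_mul_uniq a b c c' : bs_mul a b c -> bs_mul a b c' -> c = c'.
Proof. by move=> [_ ce] [_ ce']; apply/val_inj; rewrite ce ce'. Qed.

Lemma bs_mul_src a b c : bs_mul a b c -> bs_src c = bs_src a.
Proof. by move=> [_ ce]; apply/val_inj; rewrite /= ce. Qed.

Lemma bs_mul_tgt a b c : bs_mul a b c -> bs_tgt c = bs_tgt b.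
Proof. by move=> [be ce]; apply/val_inj; rewrite /= ce be /= gtargetD. Qed.

Lemma bs_mulA a b c ab bc abc :
  bs_mul a b ab -> bs_mul b c bc -> bs_mul ab c abc -> bs_mul a bc abc.
Proof.
move=> [be abe] [ce bce] [_ abce]; split; first by rewrite bce.
by rewrite abce abe bce /= addrA.
Qed.

Lemma bs_one_src u : bs_src (bs_one u) = u.
Proof. exact/val_inj. Qed.

Lemma bs_one_tgt u : bs_tgt (bs_one u) = u.
Proof. by apply/val_inj; rewrite /= gtarget0. Qed.

Lemma bs_mul1l a : bs_mul (bs_one (bs_src a)) a a.
Proof.
split => /=; first by rewrite gtarget0.
by rewrite add0r -surjective_pairing.
Qed.

Lemma bs_mul1r a : bs_mul a (bs_one (bs_tgt a)) a.
Proof. by split => //=; rewrite addr0 -surjective_pairing. Qed.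

Lemma bs_mulV a : bs_mul a (bs_inv a) (bs_one (bs_src a)).
Proof. by split => //=; rewrite subrr. Qed.

Lemma bs_mulVl a : bs_mul (bs_inv a) a (bs_one (bs_tgt a)).
Proof. by split => /=; rewrite ?addNr// -gtargetD subrr gtarget0. Qed.

Lemma gtarget_cont n : continuous (fun g : 'rV[R]_n * 'rV[R]_n => gtarget g.1 g.2).
Proof.
apply: cont_mx => i j g; rewrite (_ : i = 0) ?ord1//.
under eq_fun do rewrite mxE.
have C1 := cont_comp (@cont_fst 'rV[R]_n 'rV[R]_n) (@coord_cont R 1 n 0 j).
have C2 := cont_comp (@cont_snd 'rV[R]_n 'rV[R]_n) (@coord_cont R 1 n 0 j).
apply: cvgD; first exact: cvg_cst.
apply: cvgM.
  apply: (@cont_comp _ _ _ (fun g : 'rV[R]_n * 'rV[R]_n => - g.2 0 j) expR).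
    by move=> y; apply: cvgN; exact: C2.
  exact: continuous_expR.
by apply: cvgB; [apply: cvgD; [exact: C1|exact: cvg_cst]|exact: cvg_cst].
Qed.

Lemma bs_src_cont : continuous bs_src.
Proof. apply: sub_cont. exact: (cont_comp (@val_cont _ _) (@cont_fst _ _)). Qed.

Lemma bs_tgt_cont : continuous bs_tgt.
Proof. apply: sub_cont. exact: (cont_comp (@val_cont _ _) (@gtarget_cont _)). Qed.

Lemma bs_one_cont : continuous bs_one.
Proof.
apply: sub_cont; apply: cont_pair; first exact: val_cont.
exact: cst_continuous.
Qed.

Lemma bs_inv_cont : continuous bs_inv.
Proof.
apply: sub_cont; apply: cont_pair.
  exact: (cont_comp (@val_cont _ bs_arr) (@gtarget_cont m.+1)).
move=> g; have C := cont_comp (@val_cont _ bs_arr) (@cont_snd 'rV_m.+1 'rV_m.+1).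
by apply: cvgN; [exact: (nbhs_filter g)|exact: C].
Qed.

Lemma bs_mul_cont a b c : bs_mul a b c -> forall U, nbhs c U ->
  \forall ab \near (a, b), forall d, bs_mul ab.1 ab.2 d -> U d.
Proof.
move=> [_ ce] U [_ [[W oW <-] /= Wc] WU].
have C : continuous (fun ab : bs_arr * bs_arr =>
    ((val ab.1).1, (val ab.1).2 + (val ab.2).2)).
  have V := @val_cont _ bs_arr.
  have C1 := cont_comp (@cont_fst bs_arr bs_arr) V.
  have C2 := cont_comp (@cont_snd bs_arr bs_arr) V.
  apply: cont_pair; first exact: (cont_comp C1 (@cont_fst _ _)).
  by apply: cont_mxD; [exact: (cont_comp C1 (@cont_snd _ _))|
                       exact: (cont_comp C2 (@cont_snd _ _))].
have := C (a, b) W; rewrite -ce => /(_ (open_nbhs_nbhs (conj oW Wc))).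
by apply: (@filterS _ (nbhs (a, b)) (nbhs_filter (a, b))) => ab Wab d [_ de]; apply: WU; rewrite /= [set_val d]de.
Qed.
End BohrSommerfeld.

(* int carries the discrete topology; None is the point at infinity of Zbar. *)
HB.instance Definition _ := hasNbhs.Build int principal_filter.
HB.instance Definition _ := Discrete_ofNbhs.Build int erefl.

Definition Zbar := one_point_compactification int.
HB.instance Definition _ := Topological.on Zbar.


(* The topological quotient of T by the equivalence relation generated by r. *)
Section GeneratedQuotient.
Local Open Scope quotient_scope.
Variables (T : topologicalType) (r : T -> T -> Prop).

Definition gen_rel : rel T := fun a b => `[< clos_refl_sym_trans T r a b >].

Lemma gen_rel_refl : reflexive gen_rel.
Proof. by move=> a; apply/asboolP; exact: rst_refl. Qed.
Lemma gen_rel_sym : symmetric gen_rel.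
Proof. by move=> a b; apply/asboolP/asboolP; exact: rst_sym. Qed.
Lemma gen_rel_trans : transitive gen_rel.
Proof.
move=> b a c /asboolP ab /asboolP bc; apply/asboolP; exact: rst_trans ab bc.
Qed.

Canonical gen_equiv := EquivRel gen_rel gen_rel_refl gen_rel_sym gen_rel_trans.

Definition gen_quot := quotient_topology {eq_quot gen_equiv}.
HB.instance Definition _ := Topological.on gen_quot.

Definition cls (a : T) : gen_quot := \pi_(quotient_topology {eq_quot gen_equiv}) a.

Lemma clsP a b : cls a = cls b <-> clos_refl_sym_trans T r a b.
Proof.
split=> [/eqmodP/asboolP//|ab]; first by apply/eqmodP/asboolP.
Qed.

Lemma cls_surj (A : gen_quot) : exists a, cls a = A.
Proof. exists (repr (A : quotient_topology {eq_quot gen_equiv})); exact: reprK. Qed.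

Definition clsrepr (A : gen_quot) : T :=
  repr (A : quotient_topology {eq_quot gen_equiv}).
Lemma clsreprK A : cls (clsrepr A) = A.
Proof. exact: reprK. Qed.

Lemma cls_cont : continuous cls.
Proof. exact: pi_continuous. Qed.

Lemma gen_quot_continuous (S : topologicalType) (f : gen_quot -> S) :
  continuous (fun a => f (cls a)) -> continuous f.
Proof. by move=> cf; apply/quotient_continuous. Qed.

Lemma gen_quot_open (U : set gen_quot) : open (cls @^-1` U) -> open U.
Proof. by []. Qed.
End GeneratedQuotient.

(* The quotient groupoid for the sphere of dimension 2 n - 1, with m = n - 1. *)
Section Sheu.
Variable m : nat.
Implicit Types (w : 'rV[Zbar]_m) (x : 'rV[int]_m) (z : int).

Definition Nbar : set Zbar := [set v | if v is Some a then 0 <= a else True].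

Definition zshift (v : Zbar) (k : int) : Zbar :=
  if v is Some a then Some (a + k) else None.

Definition wadd (w : 'rV[Zbar]_m) (x : 'rV[int]_m) : 'rV[Zbar]_m :=
  \row_i zshift (w 0 i) (x 0 i).

Definition sheu_obj : set 'rV[Zbar]_m := [set w | forall i, Nbar (w 0 i)].

Definition sheu_arr : set (int * 'rV[int]_m * 'rV[Zbar]_m) :=
  [set g | let: (z, x, w) := g in
    [/\ sheu_obj w, sheu_obj (wadd w x)
      & forall i, w 0 i = None ->
          z = - (\sum_j x 0 j) /\ forall k : 'I_m, (i < k)%N -> x 0 k = 0]].

Definition truncw (i : 'I_m) (w : 'rV[Zbar]_m) : 'rV[Zbar]_m :=
  \row_k if (k <= i)%N then w 0 k else None.

(* w' = (w_1, .., w_i, oo, .., oo) for some i with w_i = oo. This relation is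
   not symmetric: the quotients below are by the equivalence it generates. *)
Definition stepw (w w' : 'rV[Zbar]_m) :=
  exists2 i, w 0 i = None & w' = truncw i w.

Definition step_obj (u v : sheu_obj) := stepw (val u) (val v).
Definition step_arr (a b : sheu_arr) :=
  (val b).1 = (val a).1 /\ stepw (val a).2 (val b).2.

Definition fq_obj := gen_quot step_obj.
Definition fq_arr := gen_quot step_arr.

Definition agree (w w' : 'rV[Zbar]_m) :=
  forall k : 'I_m, (forall j : 'I_m, (j < k)%N -> w 0 j <> None) ->
    w 0 k = w' 0 k.

Lemma agree_refl w : agree w w. Proof. by []. Qed.

Lemma agree_fin w w' (k : 'I_m) : agree w w' ->
  (forall j : 'I_m, (j < k)%N -> w' 0 j <> None) ->
  (forall j : 'I_m, (j < k)%N -> w 0 j <> None).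
Proof.
move=> A H j; have [n] := ubnP (nat_of_ord j); elim: n j => // n IH j jn jk.
rewrite (A j); first exact: H.
by move=> l lj; apply: IH; [exact: leq_trans lj jn|exact: ltn_trans lj jk].
Qed.

Lemma agree_sym w w' : agree w w' -> agree w' w.
Proof. by move=> A k H; rewrite (A k)//; exact: agree_fin H. Qed.

Lemma agree_trans w w' w'' : agree w w' -> agree w' w'' -> agree w w''.
Proof.
move=> A B k H; rewrite (A k)// (B k)//.
exact: agree_fin (agree_sym A) H.
Qed.

Lemma agree_trunc i w : w 0 i = None -> agree w (truncw i w).
Proof.
move=> wi k H; rewrite mxE; case: leqP => // ik.
by case: (H _ ik).
Qed.

Lemma agree_wadd w w' x : agree w w' -> agree (wadd w x) (wadd w' x).
Proof.
move=> A k H; rewrite !mxE (A k)// => j jk wj.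
by apply: (H j jk); rewrite mxE wj.
Qed.

Lemma agree_split w w' : agree w w' ->
  w = w' \/ exists i, [/\ w 0 i = None, w' 0 i = None & truncw i w = truncw i w'].
Proof.
move=> A; have [[i wi]|nw] := pselect (exists i, w 0 i = None); last first.
  left; apply/rowP => k; apply: A => j _ wj; apply: nw; by exists j.
right; have ex : exists n, [exists i : 'I_m, (i == n :> nat) && (w 0 i == None)].
  by exists i; apply/existsP; exists i; rewrite eqxx wi /=.
case: (ex_minnP ex) => n /existsP[k /andP[/eqP kn /eqP wk]] mn.
have H (l : 'I_m) : (l <= k)%N -> forall j : 'I_m, (j < l)%N -> w 0 j <> None.
  move=> lk j jl wj; have := mn j; rewrite leqNgt -kn (leq_trans jl lk).
  by move=> /(_ _)/negP; case=> //; apply/existsP; exists j; rewrite eqxx wj.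
exists k; split => //; first by rewrite -A//; exact: H.
by apply/rowP => l; rewrite !mxE; case: ifP => // lk; apply: A; exact: H.
Qed.

Lemma sheu_obj_trunc i w : sheu_obj w -> sheu_obj (truncw i w).
Proof. by move=> H k; rewrite mxE; case: ifP. Qed.

Lemma wadd_trunc i w x : wadd (truncw i w) x = truncw i (wadd w x).
Proof. by apply/rowP => k; rewrite !mxE; case: ifP. Qed.

Lemma sheu_arr_trunc i z x w : w 0 i = None ->
  sheu_arr (z, x, w) -> sheu_arr (z, x, truncw i w).
Proof.
move=> wi [H1 H2 H3]; split; first exact: sheu_obj_trunc.
  by rewrite wadd_trunc; exact: sheu_obj_trunc.
move=> j; rewrite mxE; case: leqP => ij wj; first exact: H3.
have [-> xi] := H3 _ wi; split=> // k jk; apply: xi; exact: ltn_trans jk.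
Qed.

Lemma cls_objP (u v : sheu_obj) :
  cls step_obj u = cls step_obj v <-> agree (val u) (val v).
Proof.
split=> [/clsP|/agree_split[/val_inj->//|[i [ui vi e]]]].
  elim=> [a b [i ai ->]|a|a b _|a b c _ ab _]; first exact: agree_trunc.
  - exact: agree_refl.
  - exact: agree_sym.
  - exact: agree_trans.
pose tu : sheu_obj :=
  exist _ (truncw i (val u)) (mem_set (sheu_obj_trunc i (set_mem (valP u)))).
apply/clsP; apply: (@rst_trans _ _ _ tu).
  by apply: rst_step; exists i.
by apply/rst_sym/rst_step; exists i.
Qed.

Lemma cls_arrP (a b : sheu_arr) :
  cls step_arr a = cls step_arr b <->
  (val a).1 = (val b).1 /\ agree (val a).2 (val b).2.
Proof.
split=> [/clsP|].
  elim=> [c d [-> [i ci ->]]|c|c d _ [-> ?]|c d e _ [-> cd] _ [-> de]].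
  - by split=> //; exact: agree_trunc.
  - by split=> //; exact: agree_refl.
  - by split=> //; exact: agree_sym.
  - by split=> //; exact: agree_trans de.
case: a b => -[zx w] aP [[zx' w'] bP] /= [e]; move: zx' e bP => _ <- bP.
case: zx aP bP => z x aP bP /agree_split[e|[i [wi wi' e]]].
  by congr cls; apply/val_inj; rewrite /= e.
pose tu : sheu_arr := exist _ (z, x, truncw i w)
  (mem_set (sheu_arr_trunc wi (set_mem aP))).
apply/clsP; apply: (@rst_trans _ _ _ tu).
  by apply: rst_step; split => //; exists i.
by apply/rst_sym/rst_step; split=> //; exists i.
Qed.

Lemma sheu_srcP g : sheu_arr g -> sheu_obj g.2.
Proof. by case: g => -[z x] w []. Qed.
Lemma sheu_tgtP g : sheu_arr g -> sheu_obj (wadd g.2 g.1.2).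
Proof. by case: g => -[z x] w []. Qed.

Definition sheu_src (g : sheu_arr) : sheu_obj :=
  exist _ (val g).2 (mem_set (sheu_srcP (set_mem (valP g)))).
Definition sheu_tgt (g : sheu_arr) : sheu_obj :=
  exist _ (wadd (val g).2 (val g).1.2) (mem_set (sheu_tgtP (set_mem (valP g)))).

Lemma zshift0 v : zshift v 0 = v. Proof. by case: v => //= a; rewrite addr0. Qed.
Lemma zshiftD v a b : zshift v (a + b) = zshift (zshift v a) b.
Proof. by case: v => //= c; rewrite addrA. Qed.
Lemma zshift_None v a : (zshift v a = None) <-> (v = None).
Proof. by case: v. Qed.

Lemma wadd0 w : wadd w 0 = w.
Proof. by apply/rowP => i; rewrite !mxE zshift0. Qed.
Lemma waddD w x y : wadd w (x + y) = wadd (wadd w x) y.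
Proof. by apply/rowP => i; rewrite !mxE zshiftD. Qed.

Lemma sheu_oneP w : sheu_obj w -> sheu_arr (0, 0, w).
Proof.
move=> H; split => //; first by rewrite wadd0.
move=> i _; split; last by move=> k _; rewrite mxE.
by rewrite big1 ?oppr0// => j _; rewrite mxE.
Qed.
Definition sheu_one (w : sheu_obj) : sheu_arr :=
  exist _ (0, 0, val w) (mem_set (sheu_oneP (set_mem (valP w)))).

Lemma sheu_invP z x w : sheu_arr (z, x, w) -> sheu_arr (- z, - x, wadd w x).
Proof.
move=> [H1 H2 H3]; split => //; first by rewrite -waddD subrr wadd0.
move=> i; rewrite mxE => /zshift_None /H3[-> xk]; split.
  by congr (- _); rewrite -sumrN; apply: eq_bigr => j _; rewrite mxE.
by move=> k ik; rewrite mxE xk ?oppr0.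
Qed.
Lemma sheu_inv_subproof (g : sheu_arr) :
  sheu_arr (- (val g).1.1, - (val g).1.2, wadd (val g).2 (val g).1.2).
Proof. by apply: sheu_invP; case: g => -[[z x] w] H; exact: set_mem H. Qed.
Definition sheu_inv (g : sheu_arr) : sheu_arr :=
  exist _ (- (val g).1.1, - (val g).1.2, wadd (val g).2 (val g).1.2)
    (mem_set (sheu_inv_subproof g)).

Lemma sheu_mulP z x w z' x' :
  sheu_arr (z, x, w) -> sheu_arr (z', x', wadd w x) ->
  sheu_arr (z + z', x + x', w).
Proof.
move=> [H1 H2 H3] [_ H5 H6]; split => //; first by rewrite waddD.
move=> i wi; have [-> xk] := H3 i wi.
have [|-> xk'] := H6 i; first by rewrite mxE wi.
split; last by move=> k ik; rewrite mxE xk ?xk' ?addr0.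
by rewrite -opprD -big_split; congr (- _); apply: eq_bigr => j _; rewrite mxE.
Qed.

Definition sheu_mul (g g' g'' : sheu_arr) :=
  (val g').2 = wadd (val g).2 (val g).1.2 /\
  val g'' = ((val g).1.1 + (val g').1.1, (val g).1.2 + (val g').1.2, (val g).2).

Lemma sheu_mul_ex a b : (val b).2 = wadd (val a).2 (val a).1.2 ->
  exists c, sheu_mul a b c.
Proof.
case: a b => -[[z x] w] aP [[[z' x'] w'] bP] /= e; move: bP; rewrite e => bP.
by exists (exist _ (z + z', x + x', w)
  (mem_set (sheu_mulP (set_mem aP) (set_mem bP)))).
Qed.

Definition fq_src (A : fq_arr) : fq_obj := cls _ (sheu_src (clsrepr A)).
Definition fq_tgt (A : fq_arr) : fq_obj := cls _ (sheu_tgt (clsrepr A)).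
Definition fq_one (U : fq_obj) : fq_arr := cls _ (sheu_one (clsrepr U)).
Definition fq_inv (A : fq_arr) : fq_arr := cls _ (sheu_inv (clsrepr A)).
(* AB = C when some representatives of A and B are composable, with product
   in C. *)
Definition fq_mul (A B C : fq_arr) :=
  exists a b c, [/\ sheu_mul a b c, cls _ a = A, cls _ b = B & cls _ c = C].

Lemma fq_srcE a : fq_src (cls _ a) = cls _ (sheu_src a).
Proof. by apply/cls_objP; have /cls_arrP[] := clsreprK (cls step_arr a). Qed.
Lemma fq_tgtE a : fq_tgt (cls _ a) = cls _ (sheu_tgt a).
Proof.
apply/cls_objP; have /cls_arrP[/= e A] := clsreprK (cls step_arr a).
by rewrite e; exact: agree_wadd.
Qed.
Lemma fq_oneE u : fq_one (cls _ u) = cls _ (sheu_one u).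
Proof.
by apply/cls_arrP; split => //=; have /cls_objP := clsreprK (cls step_obj u).
Qed.
Lemma fq_invE a : fq_inv (cls _ a) = cls _ (sheu_inv a).
Proof.
apply/cls_arrP; have /cls_arrP[/= e A] := clsreprK (cls step_arr a).
by rewrite /= e; split => //; exact: agree_wadd.
Qed.

Lemma lift_src (u : sheu_obj) (b : sheu_arr) :
  agree (val u) (val b).2 ->
  exists b' : sheu_arr, (val b').2 = val u /\ cls step_arr b' = cls step_arr b.
Proof.
case: u b => u uP [[[z x] w] bP] /= A.
have bu : sheu_arr (z, x, u).
  have [->|[i [ui wi /rowP e]]] := agree_split A; first exact: set_mem bP.
  have [H1 H2 H3] := set_mem bP.
  have e' (l : 'I_m) : (l <= i)%N -> u 0 l = w 0 l.
    by move=> li; have := e l; rewrite !mxE li.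
  have [zE x0] := H3 _ wi.
  have H0 : sheu_obj u by exact: set_mem uP.
  split => // j.
    have [ji|ij] := leqP j i; last by rewrite mxE x0// zshift0.
    by have := H2 j; rewrite !mxE e'.
  have [ji|ij] := leqP j i; first by rewrite e'//; exact: H3.
  by move=> _; split => // k jk; apply: x0; exact: ltn_trans jk.
by exists (exist _ (z, x, u) (mem_set bu)); split => //; apply/cls_arrP.
Qed.

Lemma fq_mul_ex A B : (exists C, fq_mul A B C) <-> fq_tgt A = fq_src B.
Proof.
split=> [[C [a [b [c [[e _] <- <- _]]]]]|].
  by rewrite fq_tgtE fq_srcE; congr cls; exact/val_inj.
have [[a <-] [b <-]] := (cls_surj A, cls_surj B).
rewrite fq_tgtE fq_srcE => /cls_objP/lift_src[b' [eb <-]].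
have [c abc] := sheu_mul_ex eb.
by exists (cls _ c); exists a, b', c.
Qed.

Lemma fq_mul_uniq A B C C' : fq_mul A B C -> fq_mul A B C' -> C = C'.
Proof.
move=> [a [b [c [[_ ce] <- <- <-]]]] [a' [b' [c' [[_ ce'] /cls_arrP[ea Aa] eb <-]]]].
move/cls_arrP: eb => [eb _].
by apply/cls_arrP; rewrite ce ce' ea eb; split=> //=; exact: agree_sym.
Qed.

Lemma fq_mul_src A B C : fq_mul A B C -> fq_src C = fq_src A.
Proof.
move=> [a [b [c [[_ ce] <- _ <-]]]]; rewrite !fq_srcE; congr cls.
by apply/val_inj; rewrite /= ce.
Qed.

Lemma fq_mul_tgt A B C : fq_mul A B C -> fq_tgt C = fq_tgt B.
Proof.
move=> [a [b [c [[be ce] _ <- <-]]]]; rewrite !fq_tgtE; congr cls.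
by apply/val_inj; rewrite /= ce be /= waddD.
Qed.

Lemma fq_mulA A B C AB BC ABC :
  fq_mul A B AB -> fq_mul B C BC -> fq_mul AB C ABC -> fq_mul A BC ABC.
Proof.
move=> [a [b [ab [[be abe] aA bB abAB]]]] BCm ABCm.
have /fq_mul_ex := ex_intro _ _ BCm.
have [c cC] := cls_surj C; rewrite -bB -cC fq_tgtE fq_srcE.
move=> /cls_objP/lift_src[c' [ce c'c]].
have [bc bcm] := sheu_mul_ex ce.
have [be' bce] := bcm.
have [abc abcm] : exists abc, sheu_mul a bc abc.
  by apply: sheu_mul_ex; rewrite bce be.
have -> : BC = cls _ bc.
  by apply: (fq_mul_uniq BCm); exists b, c', bc; rewrite c'c cC.
have -> : ABC = cls _ abc; last by exists a, bc, abc.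
apply: (fq_mul_uniq ABCm); exists ab, c', abc; rewrite c'c cC; split => //.
have [_ abce] := abcm.
by split; rewrite ?abce ?ce ?bce ?abe /= ?be ?waddD ?addrA.
Qed.

Lemma fq_one_src U : fq_src (fq_one U) = U.
Proof.
have [u <-] := cls_surj U; rewrite fq_oneE fq_srcE; congr cls; exact/val_inj.
Qed.

Lemma fq_one_tgt U : fq_tgt (fq_one U) = U.
Proof.
have [u <-] := cls_surj U; rewrite fq_oneE fq_tgtE; congr cls.
by apply/val_inj; rewrite /= wadd0.
Qed.

Lemma fq_mul1l A : fq_mul (fq_one (fq_src A)) A A.
Proof.
have [a <-] := cls_surj A; rewrite fq_srcE fq_oneE.
exists (sheu_one (sheu_src a)), a, a; split=> //; split => /=.
  by rewrite wadd0.
by rewrite !add0r; case: (val a) => -[].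
Qed.

Lemma fq_mul1r A : fq_mul A (fq_one (fq_tgt A)) A.
Proof.
have [a <-] := cls_surj A; rewrite fq_tgtE fq_oneE.
exists a, (sheu_one (sheu_tgt a)), a; split=> //; split => //=.
by rewrite !addr0; case: (val a) => -[].
Qed.

Lemma fq_mulV A : fq_mul A (fq_inv A) (fq_one (fq_src A)).
Proof.
have [a <-] := cls_surj A; rewrite fq_srcE fq_oneE fq_invE.
exists a, (sheu_inv a), (sheu_one (sheu_src a)); split=> //; split => //=.
by rewrite !subrr.
Qed.

Lemma fq_mulVl A : fq_mul (fq_inv A) A (fq_one (fq_tgt A)).
Proof.
have [a <-] := cls_surj A; rewrite fq_tgtE fq_oneE fq_invE.
exists (sheu_inv a), a, (sheu_one (sheu_tgt a)); split=> //; split => /=.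
  by rewrite -waddD subrr wadd0.
by rewrite !addNr.
Qed.

Lemma nbhsS (S : topologicalType) (x : S) (V W : set S) :
  nbhs x V -> (forall y, V y -> W y) -> nbhs x W.
Proof. by move=> xV VW; exact: filterS xV. Qed.

Lemma nbhsI (S : topologicalType) (x : S) (V W : set S) :
  nbhs x V -> nbhs x W -> nbhs x (V `&` W).
Proof. exact: filterI. Qed.

Lemma nbhs_forall (S : topologicalType) (I : finType) (s : S)
    (P : I -> set S) :
  (forall i, nbhs s (P i)) -> nbhs s [set x | forall i, P i x].
Proof. exact: filter_forall. Qed.

Lemma discrete_mx (p q : nat) (x : 'M[int]_(p, q)) : nbhs x [set x].
Proof.
exists (fun i j => [set x i j]) => [i j|y xy]; first exact: discrete_set1.
by apply/matrixP => i j; exact: xy.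
Qed.

Lemma Zbar_nbhs_Some a : nbhs (Some a : Zbar) [set (Some a : Zbar)].
Proof. by rewrite /nbhs/= /one_point_nbhs /=; near=> b; congr Some; near: b; exact: discrete_set1.
Unshelve. all: by end_near. Qed.

Lemma zshift_cont k : continuous (zshift^~ k).
Proof.
case=> [a|] U /= HU.
  apply: (@nbhsS Zbar (Some a) _ (zshift^~ k @^-1` U) (@Zbar_nbhs_Some a)).
  by move=> _ ->; exact: nbhs_singleton HU.
have [C [cC clC] CU] := HU.
exists [set a | C (a + k)].
  split; last exact: discrete_closed.
  rewrite (_ : mkset _ = (fun b => b - k) @` C).
    apply: continuous_compact cC; apply: continuous_subspaceT => x V HV.
    apply: (@nbhsS int x _ ((fun b => b - k) @^-1` V) (@discrete_set1 _ x)).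
    by move=> _ ->; exact: nbhs_singleton HV.
  apply/seteqP; split => [b Cb|_ [c Cc <-]] /=; last by rewrite subrK.
  by exists (b + k); rewrite // addrK.
move=> _ [[b nCb <-]|->] /=; apply: CU; last by right.
by left; exists (b + k).
Qed.

Lemma wadd_cont : continuous (fun g : 'rV[int]_m * 'rV[Zbar]_m => wadd g.2 g.1).
Proof.
move=> [x w] U HU.
have C : continuous (wadd^~ x).
  apply: cont_mx => i j; rewrite (_ : i = 0) ?ord1//.
  under eq_fun do rewrite mxE.
  exact: (cont_comp (@coord_cont _ _ _ 0 j) (@zshift_cont _)).
exists ([set x], wadd^~ x @^-1` U).
  by split; [exact: discrete_mx|exact: C].
by move=> [y v] /= [-> Uv].
Qed.

Definition raw_arr := (int * 'rV[int]_m * 'rV[Zbar]_m)%type.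

Lemma raw_x_cont : continuous (fun g : raw_arr => (g.1.2, g.2)).
Proof.
apply: cont_pair; last exact: cont_snd.
exact: cont_comp (@cont_fst _ _) (@cont_snd _ _).
Qed.

Lemma raw_zx_nbhs (g : raw_arr) : nbhs g [set h | h.1 = g.1].
Proof.
case: g => -[z x] w; exists ([set (z, x)], setT); last by case=> y v /= [-> _].
split; last exact: filterT.
exists ([set z], [set x]); last by case=> ? ? /= [-> ->].
by split; [exact: discrete_set1|exact: discrete_mx].
Qed.

Lemma arr_zx_nbhs (f : sheu_arr) :
  nbhs f [set h : sheu_arr | (val h).1 = (val f).1].
Proof. exact: (@val_cont _ sheu_arr f _ (raw_zx_nbhs (val f))). Qed.

Lemma fq_src_cont : continuous fq_src.
Proof.
apply: gen_quot_continuous; rewrite (_ : (fun a => _) = cls _ \o sheu_src).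
  apply: cont_comp (@cls_cont _ _); apply: sub_cont.
  exact: (cont_comp (@val_cont _ sheu_arr) (@cont_snd _ _)).
by apply/funext => a; rewrite fq_srcE.
Qed.

Lemma fq_tgt_cont : continuous fq_tgt.
Proof.
apply: gen_quot_continuous; rewrite (_ : (fun a => _) = cls _ \o sheu_tgt).
  apply: cont_comp (@cls_cont _ _); apply: sub_cont.
  exact: (cont_comp (cont_comp (@val_cont _ sheu_arr) raw_x_cont) wadd_cont).
by apply/funext => a; rewrite fq_tgtE.
Qed.

Lemma fq_one_cont : continuous fq_one.
Proof.
apply: gen_quot_continuous; rewrite (_ : (fun a => _) = cls _ \o sheu_one).
  apply: cont_comp (@cls_cont _ _); apply: sub_cont; apply: cont_pair.
    exact: cst_continuous.
  exact: val_cont.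
by apply/funext => a; rewrite fq_oneE.
Qed.

Lemma fq_inv_cont : continuous fq_inv.
Proof.
apply: gen_quot_continuous; rewrite (_ : (fun a => _) = cls _ \o sheu_inv).
  apply: cont_comp (@cls_cont _ _); apply: sub_cont; apply: cont_pair; last first.
    exact: (cont_comp (cont_comp (@val_cont _ sheu_arr) raw_x_cont) wadd_cont).
  apply: (@cont_comp _ _ _ (fun a : sheu_arr => val a)
    (fun g : raw_arr => (- g.1.1, - g.1.2)) (@val_cont _ _)).
  move=> g U HU; apply: (@nbhsS raw_arr g _
    ((fun g => (- g.1.1, - g.1.2)) @^-1` U) (raw_zx_nbhs g)).
  by move=> h /= e; rewrite /= e; exact: nbhs_singleton HU.
by apply/funext => a; rewrite fq_invE.
Qed.

(* near g, a translate of the (z, x)-part still lies in the subgroupoid *)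
Lemma near_arr (g : sheu_arr) z x :
  sheu_arr (z, x, (val g).2) ->
  \forall h \near g, sheu_arr (z, x, (val h).2).
Proof.
move=> [H1 H2 H3].
pose Q (i : 'I_m) : set Zbar := [set v |
  (Nbar v -> Nbar (zshift v (x 0 i))) /\
  (v = None -> z = - (\sum_j x 0 j) /\ forall k : 'I_m, (i < k)%N -> x 0 k = 0)].
have HQ i : nbhs ((val g).2 0 i) (Q i).
  case E : ((val g).2 0 i) => [a|].
    apply: (@nbhsS Zbar (Some a) _ (Q i) (@Zbar_nbhs_Some a)) => _ ->.
    split => // _; by have := H2 i; rewrite mxE E.
  exists [set` [seq (k%:Z : int) | k <- iota 0 (absz (x 0 i))]].
    split; last exact: discrete_closed.
    apply: finite_compact; exact: finite_seq.
  move=> _ [[a /= na <-]|->]; last by split=> // _; exact: H3.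
  split=> //= a0; rewrite leNgt; apply/negP => ax; apply: na.
  apply/mapP; exists (absz a); last by rewrite gez0_abs.
  rewrite mem_iota /= add0n; lia.
have : \forall h \near g, forall i, Q i ((val (h : sheu_arr)).2 0 i).
  apply: nbhs_forall => i.
  have C := cont_comp (cont_comp (@val_cont _ sheu_arr) (@cont_snd _ _))
    (@coord_cont _ 1 m 0 i).
  exact: (C g _ (HQ i)).
apply: filterS => h Qh.
have [K1 _ _] : sheu_arr ((val h).1.1, (val h).1.2, (val h).2).
  by rewrite -!surjective_pairing; exact: set_mem (valP h).
split => // i; first by rewrite mxE; have [q _] := Qh i; exact: q.
by have [_ q] := Qh i.
Qed.

Lemma fq_mul_cont A B C : fq_mul A B C -> forall U, nbhs C U ->
  \forall AB \near (A, B), forall D, fq_mul AB.1 AB.2 D -> U D.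
Proof.
move=> [a [b [c [[be ce] <- <- <-]]]] U; rewrite nbhsE => -[W [oW Wc] WU].
pose z := (val a).1.1 + (val b).1.1; pose x := (val a).1.2 + (val b).1.2.
pose V : set sheu_arr := [set f | (val f).1 = (val a).1 /\
  exists2 g : sheu_arr, val g = (z, x, (val f).2) & W (cls _ g)].
have Vsat f f' : cls step_arr f = cls step_arr f' -> V f -> V f'.
  move=> /cls_arrP[e fA] [fa [g ge Wg]]; split; first by rewrite -e.
  have gP : sheu_arr (z, x, (val g).2).
    by have := set_mem (valP g); rewrite {1}ge [(val g).2](congr1 snd ge).
  have [|g' [g'e gg']] := @lift_src (sheu_src f') g.
    by rewrite ge /=; exact: agree_sym.
  exists g'; last by rewrite gg'.
  have /cls_arrP[e' _] := gg'.
  by rewrite (surjective_pairing (val g')) e' g'e ge.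
have oV : open V.
  rewrite openE => f [fa [g ge Wg]].
  have gP : sheu_arr (z, x, (val f).2) by rewrite -ge; exact: set_mem (valP g).
  pose M (h : sheu_arr) : sheu_arr := insubd g (z, x, (val h).2).
  have ME h : sheu_arr (z, x, (val h).2) -> val (M h) = (z, x, (val h).2).
    by move=> H; rewrite val_insubd mem_set.
  have Mf : M f = g by apply/val_inj; rewrite ME.
  have near_f := near_arr gP.
  have near_a : nbhs f [set h : sheu_arr | (val h).1 = (val a).1].
    by have := arr_zx_nbhs f; rewrite fa.
  have Mcont : M @ f --> g.
    move=> X HX; move: (HX); rewrite [in X in X -> _]nbhsE => -[Y [[N oN <-] /= Ng] OW].
    have C1 : continuous (fun h : sheu_arr => ((z, x, (val h).2) : raw_arr)).
      apply: cont_pair; first exact: cst_continuous.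
      exact: (cont_comp (@val_cont _ sheu_arr) (@cont_snd _ _)).
    have nO : nbhs (val g) N by exact: open_nbhs_nbhs.
    have := C1 f N; rewrite -ge => /(_ nO) nO'.
    apply: (@nbhsS _ f _ (M @^-1` X) (nbhsI near_f nO')) => h [h1 h2]; apply: OW => /=.
    by rewrite [set_val _](ME _ h1).
  have nW : nbhs g (cls step_arr @^-1` W).
    exact: (@cls_cont _ step_arr g W (open_nbhs_nbhs (conj oW Wg))).
  have near_W := Mcont _ nW.
  apply: (nbhsS (nbhsI near_f (nbhsI near_a near_W))) => h [h1 [h2 h3]].
  by split => //; exists (M h) => //; exact: ME.
pose VA := cls step_arr @` V.
have oVA : open VA.
  apply: gen_quot_open; rewrite (_ : _ @^-1` _ = V)//.
  apply/seteqP; split=> f; last by move=> Vf; exists f.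
  by move=> [f' Vf' e]; exact: Vsat Vf'.
pose VB0 : set sheu_arr := [set f | (val f).1 = (val b).1].
pose VB := cls step_arr @` VB0.
have oVB : open VB.
  apply: gen_quot_open; rewrite (_ : _ @^-1` _ = VB0).
    by rewrite openE => f fb; have := arr_zx_nbhs f; rewrite fb.
  apply/seteqP; split=> f; last by move=> Vf; exists f.
  by move=> [f' f'b /cls_arrP[e _]]; rewrite /VB0 /= -e.
exists (VA, VB).
  split; apply: open_nbhs_nbhs; split => //=; last by exists b.
  by exists a => //; split => //; exists c.
move=> [A' B'] /= [VA' VB'] D [a' [b' [c' [[b'e c'e] a'A b'B <-]]]]; apply: WU.
have Va' : V a'.
  by case: VA' => f Vf e; apply: Vsat Vf; rewrite e.
have b'b : (val b').1 = (val b).1.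
  by case: VB' => f fb; rewrite -b'B => /cls_arrP[<- _].
have [a'a [g ge Wg]] := Va'.
suff -> : c' = g by [].
by apply/val_inj; rewrite c'e ge a'a b'b.
Qed.
End Sheu.

Arguments bs_obj {R} m t hbar _.
Arguments bs_arr {R} m t hbar _.
Arguments sheu_obj m _ : clear implicits.
Arguments sheu_arr m _ : clear implicits.

Definition bs_groupoid (R : realType) (m : nat) (t hbar : R) : topGroupoid :=
  @TopGroupoid (bs_obj m t hbar) (bs_arr m t hbar)
    (@bs_src R m t hbar) (@bs_tgt R m t hbar) (@bs_one R m t hbar)
    (@bs_inv R m t hbar) (@bs_mul R m t hbar)
    (@bs_mul_ex R m t hbar) (@bs_mul_uniq R m t hbar)
    (@bs_mul_src R m t hbar) (@bs_mul_tgt R m t hbar) (@bs_mulA R m t hbar)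
    (@bs_one_src R m t hbar) (@bs_one_tgt R m t hbar)
    (@bs_mul1l R m t hbar) (@bs_mul1r R m t hbar)
    (@bs_mulV R m t hbar) (@bs_mulVl R m t hbar)
    (@bs_src_cont R m t hbar) (@bs_tgt_cont R m t hbar)
    (@bs_one_cont R m t hbar) (@bs_inv_cont R m t hbar)
    (@bs_mul_cont R m t hbar).

Definition sheu_groupoid (m : nat) : topGroupoid :=
  @TopGroupoid (fq_obj m) (fq_arr m)
    (@fq_src m) (@fq_tgt m) (@fq_one m) (@fq_inv m) (@fq_mul m)
    (@fq_mul_ex m) (@fq_mul_uniq m) (@fq_mul_src m) (@fq_mul_tgt m) (@fq_mulA m)
    (@fq_one_src m) (@fq_one_tgt m) (@fq_mul1l m) (@fq_mul1r m)
    (@fq_mulV m) (@fq_mulVl m)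
    (@fq_src_cont m) (@fq_tgt_cont m) (@fq_one_cont m) (@fq_inv_cont m)
    (@fq_mul_cont m).

Section Phi.
Context {R : realType}.
Variables (m : nat) (t hbar : R).

(* e^{-hbar v}, with the convention e^{-hbar oo} = 0 *)
Definition expZbar (v : Zbar) : R :=
  if v is Some q then expR (- (hbar * q%:~R)) else 0.

Definition Phi_coords (g : 'rV[R]_m.+1 * 'rV[R]_m.+1)
    (p : 'rV[int]_m.+1) (q : 'rV[Zbar]_m) :=
  (forall k, g.2 0 k = hbar * (p 0 k)%:~R) /\
  (forall k : 'I_m,
    g.1 0 (widen_ord (leqnSn m) k) = 1 - t - expZbar (q 0 k)).

(* the value of f at the index preceding k, and f0 at the first index *)
Definition prev (A : Type) (f0 : A) (f : 'I_m -> A) (k : 'I_m) : A :=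
  if k == 0%N :> nat then f0
  else f (Ordinal (leq_ltn_trans (leq_pred k) (ltn_ord k))).

Definition Phi_z (p : 'rV[int]_m.+1) : int := - p 0 ord_max.

Definition Phi_x (p : 'rV[int]_m.+1) : 'rV[int]_m :=
  let p' := fun k : 'I_m => p 0 (widen_ord (leqnSn m) k) in
  \row_k (p' k - prev 0 p' k).

(* w is an admissible (q_1 - qt, q_2 - q_1, ...): an entry oo - oo stands for
   an arbitrary element of Nbar, every other entry is determined *)
Definition Phi_w (qt : int) (q w : 'rV[Zbar]_m) :=
  forall k, if prev (Some qt) (q 0) k is Some b
            then w 0 k = zshift (q 0 k) (- b) else Nbar (w 0 k).

(* The entry q_1 - q_t only makes sense when q_t is an integer (or m = 0).
   As q_1 is an integer or oo, 0 <= c_1 says q_t <= q_1, i.e. ceil q_t <= q_1;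
   rounding up thus gives a meaning to the entry for every t, and changes
   nothing when q_t is an integer. *)
Definition q_t : int := Num.ceil (- hbar^-1 * ln (1 - t)).

End Phi.

(* Main.v *)
(* With E(v) = exp(-hbar v), the inverse of Phi sends the class of (z; x; w) to
   c_k = 1 - t - E(q_t) E(w_1) ... E(w_k), h_k = hbar (x_1 + ... + x_k) for
   k < n, and c_n = 1 - t, h_n = - hbar z. The products vanish from the first
   infinite w_i on, so they depend on the class only, and they determine it: this
   map, called realize on representatives, induces a continuous bijection. Its
   inverse is continuous because, h being locally constant, only c varies, and
   the w with w and w + x in Nbar^(n-1) form a compact space. On the spaces of
   objects, everything follows by restricting to units. *)
Require Import Defs.
From mathcomp Require Import all_boot all_order all_algebra.
From mathcomp Require Import all_classical all_reals all_analysis.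
From mathcomp Require Import ring lra zify.

Set Implicit Arguments.
Unset Strict Implicit.
Unset Printing Implicit Defensive.

Import Order.TTheory GRing.Theory Num.Theory.
Import numFieldNormedType.Exports.
Local Open Scope classical_set_scope.
Local Open Scope ring_scope.

(** * Isomorphisms of topological groupoids from maps of arrows *)

Lemma gmul_idem (G : topGroupoid) (e : garr G) :
  gmul e e e -> e = gone (gsrc e).
Proof.
move=> ee; have st : gtgt e = gsrc e by apply/gmul_ex; exists e.
have e1 := gmulA ee (gmulV e) (gmulV e).
by have := gmul1r e; rewrite st => e2; exact: gmul_uniq e2 e1.
Qed.

(** [F] maps units to idempotents, which are units by cancellation. This gives the map of objects,
    and the same formula applied to [F'] gives its inverse. *)
Lemma topGroupoid_iso_of_arrows (G H : topGroupoid) (F : garr G -> garr H) :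
  homeomorphism F ->
  (forall a b c, gmul a b c -> gmul (F a) (F b) (F c)) ->
  topGroupoid_iso F.
Proof.
move=> homeoF FM; split; first exact: homeoF.
have [cF [F' [cF' FK F'K]]] := homeoF.
have idem (K : topGroupoid) (u : gobj K) : gmul (gone u) (gone u) (gone u).
  by have := gmul1l (gone u); rewrite gone_src.
have F1 u : F (gone u) = gone (gsrc (F (gone u))).
  exact/gmul_idem/FM.
have Fsrc a : gsrc (F a) = gsrc (F (gone (gsrc a))).
  exact: gmul_src (FM _ _ _ (gmul1l a)).
have Ftgt a : gtgt (F a) = gsrc (F (gone (gtgt a))).
  by rewrite (gmul_tgt (FM _ _ _ (gmul1r a))) [in LHS]F1 gone_tgt.
exists (fun u => gsrc (F (gone u))); split => //.
split.
  exact: cont_comp (cont_comp (@gone_cont G) cF) (@gsrc_cont H).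
exists (fun v => gsrc (F' (gone v))); split.
- exact: cont_comp (cont_comp (@gone_cont H) cF') (@gsrc_cont G).
- by move=> u; rewrite -F1 FK gone_src.
- by move=> v; rewrite -Fsrc F'K gone_src.
Qed.

(** * The exponential exp(-hbar v) on the compactified integers *)

Section Exponential.
Context {R : realType}.
Variable hbar : R.
Hypothesis hbar_gt0 : 0 < hbar.

(* Replacing v by its absolute value makes expZbar continuous on all of Zbar,
   without changing it on Nbar. *)
Definition expabs (v : Zbar) : R :=
  if v is Some a then expR (- (hbar * `|a|%:~R)) else 0.

Lemma expabsE v : Nbar v -> expabs v = expZbar hbar v.
Proof. by case: v => //= a a0; rewrite ger0_norm. Qed.

Lemma expabs_ge0 v : 0 <= expabs v.
Proof. by case: v => //= a; exact: expR_ge0. Qed.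

Lemma expabs_le1 v : expabs v <= 1.
Proof.
case: v => //= a; rewrite -expR0 ler_expR oppr_le0.
by apply: mulr_ge0 => //; exact: ltW.
Qed.

Lemma expabs_eq0 v : (expabs v == 0) = (v == None).
Proof. by case: v => [a|]/=; rewrite ?eqxx// gt_eqF ?expR_gt0. Qed.

Lemma expZbar_inj : injective (expZbar hbar).
Proof.
have hn0 : hbar != 0 by rewrite gt_eqF.
case=> [a|] [b|] //=.
- move=> /expR_inj/oppr_inj/(mulfI hn0)/eqP; rewrite eqr_int => /eqP->//.
- by move=> /eqP; rewrite gt_eqF ?expR_gt0.
- by move=> /esym/eqP; rewrite gt_eqF ?expR_gt0.
Qed.

Lemma expZbar_shift v a :
  expZbar hbar (zshift v a) = expR (- (hbar * a%:~R)) * expZbar hbar v.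
Proof.
case: v => [b|]/=; last by rewrite mulr0.
by rewrite -expRD rmorphD/= mulrDr opprD addrC.
Qed.

Lemma expabs_cont : continuous expabs.
Proof.
case=> [a|] U HU.
  apply: (@nbhsS _ (Some a : Zbar) _ (expabs @^-1` U) (@Zbar_nbhs_Some a)).
  by move=> _ ->; exact: nbhs_singleton HU.
have [e /= e0 eU] := HU.
(* exp(-hbar |a|) < e once |a| exceeds -(log e)/hbar, and [s] lists the integers from -|N| to
   |N|. *)
pose N : int := Num.ceil (- (hbar^-1 * ln e)).
pose s : seq int := [seq k%:Z - `|N| | k <- iota 0 (absz N).*2.+1].
exists [set` s].
  split; last exact: discrete_closed.
  apply: finite_compact; exact: finite_seq.
move=> _ [[a /= na <-]|->]; last by apply: eU; rewrite /ball_/= subrr normr0.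
apply: eU; rewrite /ball_/= sub0r normrN ger0_norm ?expR_ge0//.
rewrite -[ltRHS](@lnK _ e)// ltr_expR ltrNl.
rewrite -ltr_pdivrMl// mulrN.
apply: le_lt_trans (ceil_ge _) _; rewrite ltr_int -/N ltNge.
apply/negP => aN; apply: na.
rewrite /s; apply/mapP; exists (absz (a + `|N|)).
  rewrite mem_iota /= add0n; lia.
lia.
Qed.

(** Thanks to the ceiling, [q_t] is the least integer a with exp(-hbar a) <= 1 - t. The bound 0 <=
    c_1 thus becomes q_t <= q_1. *)
Lemma expR_qtP (t : R) (a : int) : 0 < t < 1 ->
  (expR (- (hbar * a%:~R)) <= 1 - t) = (q_t t hbar <= a).
Proof.
move=> /andP[_ t1]; rewrite -subr_gt0 in t1.
rewrite -[in LHS](@lnK _ (1 - t)) ?posrE// ler_expR /q_t ceil_le_int mulNr lerNl.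
by rewrite -mulrN ler_pdivrMl.
Qed.

End Exponential.

(** * The formulas for c and h in terms of (z; x; w) *)

Section Coordinates.
Context {R : realType}.
Variables (m : nat) (t hbar : R).
Hypothesis t_bounds : 0 < t < 1.
Hypothesis hbar_gt0 : 0 < hbar.

Notation qt := (q_t t hbar).
Implicit Types (w : 'rV[Zbar]_m) (x : 'rV[int]_m) (z : int).

(* With these values at the index m, the formulas for c_n = 1 - t and
   h_n = - hbar z become the last instances of those for c_k and h_k. *)
Definition ext_w w (j : nat) : Zbar := oapp (w 0) None (insub j).
Definition ext_x z x (j : nat) : int :=
  oapp (x 0) (- z - \sum_i x 0 i) (insub j).

Lemma ext_wE w (i : 'I_m) : ext_w w i = w 0 i.
Proof. by rewrite /ext_w valK. Qed.

Lemma ext_xE z x (i : 'I_m) : ext_x z x i = x 0 i.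
Proof. by rewrite /ext_x valK. Qed.

Lemma ext_w_out w j : (m <= j)%N -> ext_w w j = None.
Proof. by move=> mj; rewrite /ext_w insubF// ltnNge mj. Qed.

Lemma ext_Nbar w j : sheu_obj m w -> Nbar (ext_w w j).
Proof. by move=> H; rewrite /ext_w; case: insub => [i|]//=; exact: H. Qed.

Lemma ext_wadd w z x j : ext_w (wadd w x) j = zshift (ext_w w j) (ext_x z x j).
Proof. by rewrite /ext_w /ext_x; case: insub => [i|]//=; rewrite mxE. Qed.

Definition xsum z x n : int := \sum_(j < n) ext_x z x j.

Lemma xsumS z x n : xsum z x n.+1 = xsum z x n + ext_x z x n.
Proof. exact: big_ord_recr. Qed.

Lemma xsum_last z x : xsum z x m.+1 = - z.
Proof.
rewrite xsumS /xsum (eq_bigr (x 0)) => [|i _]; last exact: ext_xE.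
by rewrite /ext_x insubF ?ltnn//= addrC subrK.
Qed.

(** On Nbar this is exp(-hbar q_n) with q_0 = q_t, that is 1 - t - c_n. Using [expabs] makes it
    nonincreasing in [n] and continuous for every [w]. *)
Definition wprod w n : R :=
  expR (- (hbar * qt%:~R)) * \prod_(j < n) expabs hbar (ext_w w j).

Lemma wprod0 w : wprod w 0 = expR (- (hbar * qt%:~R)).
Proof. by rewrite /wprod big_ord0 mulr1. Qed.

Lemma wprodS w n : wprod w n.+1 = wprod w n * expabs hbar (ext_w w n).
Proof. by rewrite /wprod big_ord_recr mulrA. Qed.

Lemma wprod_ge0 w n : 0 <= wprod w n.
Proof.
by elim: n => [|n IH]; rewrite ?wprod0 ?expR_ge0// wprodS mulr_ge0// expabs_ge0.
Qed.

Lemma wprod_nincr w n k : (n <= k)%N -> wprod w k <= wprod w n.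
Proof.
elim: k => [|k IH]; first by rewrite leqn0 => /eqP->.
rewrite leq_eqVlt => /predU1P[->//|/IH]; apply: le_trans.
by rewrite wprodS ler_piMr ?wprod_ge0// expabs_le1.
Qed.

Lemma wprod_le w n : wprod w n <= 1 - t.
Proof.
apply: le_trans (wprod_nincr w (leq0n n)) _.
by rewrite wprod0 expR_qtP.
Qed.

Lemma wprod_eq0 w n : wprod w n = 0 <-> exists2 j, (j < n)%N & ext_w w j = None.
Proof.
elim: n => [|n IH].
  by rewrite wprod0; split => [/eqP|[]//]; rewrite gt_eqF// expR_gt0.
rewrite wprodS; split.
  move=> /eqP; rewrite mulf_eq0 expabs_eq0 => /orP[/eqP/IH[j jn]|/eqP].
    by exists j => //; exact: ltnW.
  by exists n.
move=> [j]; rewrite ltnS leq_eqVlt => /predU1P[->|jn] wj.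
  by rewrite wj/= mulr0.
by have /IH-> : exists2 j, (j < n)%N & ext_w w j = None; rewrite ?mul0r//; exists j.
Qed.

Fixpoint qsum w n : Zbar :=
  if n is n'.+1 then
    if ext_w w n' is Some a then zshift (qsum w n') a else None
  else Some qt.

Lemma wprod_qsum w n : sheu_obj m w -> wprod w n = expZbar hbar (qsum w n).
Proof.
move=> wN; elim: n => [|n IH]; first by rewrite wprod0.
rewrite wprodS IH expabsE/=; last exact: ext_Nbar.
by case: (ext_w w n) => [a|]/=; rewrite ?mulr0// expZbar_shift mulrC.
Qed.

Lemma qsum_shift w n b : qsum w n = Some b ->
  ext_w w n = zshift (qsum w n.+1) (- b).
Proof. by move=> /= ->; case: (ext_w w n) => //= a; rewrite addrAC subrr add0r. Qed.

(** Shifting an entry multiplies its factor by an exponential, and these collect into the partial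
    sum of x. Both [w] and its shift lie in Nbar, where [expabs] turns shifts into products. *)
Lemma wprod_wadd w z x n : sheu_obj m w -> sheu_obj m (wadd w x) ->
  wprod (wadd w x) n = expR (- (hbar * (xsum z x n)%:~R)) * wprod w n.
Proof.
move=> wN wxN; elim: n => [|n IH].
  by rewrite !wprod0 /xsum big_ord0 mulr0 oppr0 expR0 mul1r.
rewrite !wprodS IH xsumS !expabsE; [|exact: ext_Nbar..].
rewrite (ext_wadd w z) expZbar_shift rmorphD/= mulrDr opprD expRD.
by rewrite mulrACA.
Qed.

Definition cmap w : 'rV[R]_m.+1 := \row_k (1 - t - wprod w k.+1).
Definition hmap z x : 'rV[R]_m.+1 := \row_k (hbar * (xsum z x k.+1)%:~R).

Lemma cmap_Delta w : Delta (cmap w).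
Proof.
have /andP[t0 _] := t_bounds.
split=> [i|i j ij]; rewrite !mxE; last by rewrite lerD2l lerN2 wprod_nincr.
have := wprod_le w i.+1; have := wprod_ge0 w i.+1; lra.
Qed.

Lemma cmap_last w : cmap w 0 ord_max = 1 - t.
Proof. by rewrite mxE wprodS /= ext_w_out//= mulr0 subr0. Qed.

Lemma cmap_eq w k :
  cmap w 0 k = 1 - t <-> exists2 j, (j <= k)%N & ext_w w j = None.
Proof.
rewrite mxE -(wprod_eq0 w k.+1); split=> [|->]; last by rewrite subr0.
lra.
Qed.

Lemma gtarget_cmap w z x : sheu_obj m w -> sheu_obj m (wadd w x) ->
  gtarget t (cmap w) (hmap z x) = cmap (wadd w x).
Proof.
move=> wN wxN; apply/rowP => k; rewrite !mxE (wprod_wadd z)//.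
ring.
Qed.

(** The clause on z in [sheu_arr] says that the entry of [ext_x] added at the index [m] vanishes, so
    it merges with the clause on x. *)
Lemma ext_x_eq0 z x w i k : sheu_arr m (z, x, w) ->
  ext_w w i = None -> (i < k <= m)%N -> ext_x z x k = 0.
Proof.
move=> [_ _ H] wi /andP[ik km].
have im : (i < m)%N by exact: leq_trans km.
have [] := H (Ordinal im); first by rewrite -ext_wE.
rewrite /ext_x => -> xk; case: insubP => [j _ jk|]/=.
  by apply: xk; rewrite jk.
by move=> _; rewrite opprK subrr.
Qed.

Lemma cmap_bs_obj w : sheu_obj m w -> bs_obj m t hbar (cmap w).
Proof.
move=> wN; split; [exact: cmap_Delta|exact: cmap_last|].
move=> k; rewrite mxE wprod_qsum//.
case: qsum => [a|]/=; last by rewrite subr0 eqxx.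
move=> _; exists (- a) => //.
rewrite (_ : _ + t = - expR (- (hbar * a%:~R))); last by ring.
by rewrite normrN ger0_norm ?expR_ge0// expRK rmorphN/= mulrN.
Qed.

Lemma realize_bs_arr z x w : sheu_arr m (z, x, w) ->
  bs_arr m t hbar (cmap w, hmap z x).
Proof.
move=> zxw; have [wN wxN _] := zxw; have [? ? ?] := cmap_bs_obj wN.
split => //.
- split => //; rewrite gtarget_cmap//; exact: cmap_Delta.
- by move=> k; rewrite mxE; exists (xsum z x k.+1).
- move=> i j ij /cmap_eq[l li wl] _; rewrite !mxE ij (xsumS _ _ i.+1).
  have -> : ext_x z x i.+1 = 0; last by rewrite addr0.
  by apply: ext_x_eq0 zxw wl _; rewrite ltnS li -ij -ltnS ltn_ord.
Qed.

Lemma hmap_inj z x z' x' : hmap z x = hmap z' x' -> z = z' /\ x = x'.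
Proof.
move=> e; have xs n : (n <= m.+1)%N -> xsum z x n = xsum z' x' n.
  case: n => [|n nm]; first by rewrite /xsum !big_ord0.
  have /rowP/(_ (Ordinal nm)) := e; rewrite !mxE.
  by move=> /(mulfI (lt0r_neq0 hbar_gt0))/eqP; rewrite eqr_int => /eqP.
split; first by apply: oppr_inj; rewrite -(xsum_last z x) xs// xsum_last.
apply/rowP => i; rewrite -(ext_xE z) -(ext_xE z').
have := xs i.+1; rewrite ltnS ltnW// !xsumS xs; last by rewrite ltnW// ltnS ltnW.
by move=> /(_ isT)/addrI.
Qed.

(** Up to the first infinite entry the preceding product is nonzero and can be cancelled, which
    recovers the entry. From there on all products vanish, whatever the later entries. *)
Lemma cmap_agree w w' : sheu_obj m w -> sheu_obj m w' ->
  cmap w = cmap w' <-> agree w w'.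
Proof.
move=> wN w'N; split=> [e k wk|A].
  have P n : (n <= m)%N -> wprod w n = wprod w' n.
    case: n => [_|n nm]; first by rewrite !wprod0.
    have /rowP/(_ (Ordinal (leqW nm))) := e; rewrite !mxE /=; lra.
  rewrite -!ext_wE; apply: (expZbar_inj hbar_gt0).
  rewrite -!expabsE; [|exact: ext_Nbar..].
  have := P _ (ltn_ord k); rewrite !wprodS -P; last exact: ltnW.
  apply: mulfI; apply/eqP => /wprod_eq0[j jk].
  by rewrite -[j]/(val (Ordinal (ltn_trans jk (ltn_ord k)))) ext_wE; exact: wk.
suff P n : wprod w n = wprod w' n by apply/rowP => k; rewrite !mxE P.
elim: n => [|n IH]; first by rewrite !wprod0.
have [/eqP w0|w0] := boolP (wprod w n == 0); first by rewrite !wprodS -IH w0 !mul0r.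
rewrite !wprodS IH; congr (_ * expabs _ _).
have [mn|nm] := leqP m n; first by rewrite !ext_w_out.
rewrite -[n]/(val (Ordinal nm)) !ext_wE; apply: A => j jn wj.
by move/eqP: w0; apply; apply/wprod_eq0; exists j => //; rewrite ext_wE.
Qed.

End Coordinates.

(** * Surjectivity onto the Bohr-Sommerfeld groupoid *)

Section Bijection.
Context {R : realType}.
Variables (m : nat) (t hbar : R).
Hypothesis t_bounds : 0 < t < 1.
Hypothesis hbar_gt0 : 0 < hbar.

Notation qt := (q_t t hbar).
Implicit Types (w : 'rV[Zbar]_m) (x : 'rV[int]_m) (z : int).

Lemma expZbar_le (a b : int) :
  (expZbar hbar (Some a) <= expZbar hbar (Some b)) = (b <= a).
Proof. by rewrite /= ler_expR lerN2 ler_pM2l// ler_int. Qed.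

Lemma expZbar_le0 v : expZbar hbar v <= 0 -> v = None.
Proof. by case: v => //= a; rewrite leNgt expR_gt0. Qed.

(** Monotonicity gives c_k <= c_n = 1 - t, which fixes the sign: the logarithm in the
    Bohr-Sommerfeld condition is that of 1 - t - c_k. *)
Lemma bs_obj_coords c : bs_obj m t hbar c ->
  exists v : 'I_m.+1 -> Zbar, forall k, c 0 k = 1 - t - expZbar hbar (v k).
Proof.
move=> [[_ Dc] cm cZ].
suff /choice[v vE] : forall k, exists v, c 0 k = 1 - t - expZbar hbar v by exists v.
move=> k; have [ck|ck] := eqVneq (c 0 k) (1 - t).
  by exists None; rewrite ck subr0.
have [a _ ea] := cZ k ck.
have ck1 : c 0 k < 1 - t by rewrite lt_neqAle ck -cm Dc// -ltnS ltn_ord.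
exists (Some (- a)); rewrite /= rmorphN/= mulrN opprK ea lnK.
  rewrite ltr0_norm; first ring.
  lra.
rewrite posrE normr_gt0; lra.
Qed.

(* Among the many w with the same image, this one has only infinite entries
   after the first infinite one. *)
Lemma cmap_surj c : bs_obj m t hbar c -> exists w,
  [/\ sheu_obj m w, cmap t hbar w = c
    & forall i j : 'I_m, (i <= j)%N -> w 0 i = None -> w 0 j = None].
Proof.
move=> cP; have [v vE] := bs_obj_coords cP; have [[D0 Dc] cm _] := cP.
(* The index is shifted by one: [V k.+1] belongs to the coordinate [k], and [V 0] is q_0 = q_t. *)
pose V n : Zbar := if n is n'.+1 then v (inord n') else Some qt.
have VE (k : 'I_m.+1) : V k.+1 = v k by rewrite /V inord_val.
have Vle n : (0 < n <= m)%N -> expZbar hbar (V n.+1) <= expZbar hbar (V n).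
  case: n => // n /andP[_ nm].
  have nm' : (n.+1 < m.+1)%N by [].
  have := Dc (Ordinal (leqW nm)) (Ordinal nm') (leqnSn n).
  by rewrite !vE -!VE lerD2l lerN2.
(* Finite exponents are nondecreasing: for n > 0 because c is monotone, for n = 0 because c_1 >=
   0. *)
have VS n b a : (n <= m)%N -> V n = Some b -> V n.+1 = Some a -> b <= a.
  case: n => [_ [<-] Va|n nm Vb Va]; last first.
    by have := Vle n.+1; rewrite Vb Va expZbar_le; apply.
  rewrite -(expR_qtP hbar_gt0 _ t_bounds) -/(expZbar hbar (Some a)) -Va (VE ord0).
  have /andP[+ _] := D0 ord0; rewrite vE; lra.
have VN n k : (n <= k <= m.+1)%N -> V n = None -> V k = None.
  elim: k => [|k IH]; first by rewrite leqn0 andbT => /eqP->.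
  rewrite leq_eqVlt => /andP[/predU1P[->//|nk] km] Vn.
  have Vk : V k = None by apply: IH Vn; rewrite -ltnS nk ltnW.
  apply: expZbar_le0; have <- : expZbar hbar (V k) = 0 by rewrite Vk.
  apply: Vle; rewrite ltnS in km; rewrite km andbT lt0n.
  by apply: contraPneq Vk => ->.
have Vlast : V m.+1 = None.
  apply: expZbar_le0; rewrite -[m.+1]/((@ord_max m).+1) VE.
  have := vE ord_max; rewrite cm; lra.
(* Successive differences telescope in [wprod]; the default [None] produces the infinite tail. *)
pose w : 'rV[Zbar]_m := \row_k
  if V k is Some b then zshift (V k.+1) (- b) else None.
have wN : sheu_obj m w.
  move=> k; rewrite mxE; case Eb: (V k) => [b|]//; case Ea: (V k.+1) => [a|]//=.
  by rewrite subr_ge0 (VS k)// ltnW.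
have wV n : (n <= m)%N -> wprod t hbar w n = expZbar hbar (V n).
  elim: n => [|n IH] nm; first by rewrite wprod0.
  rewrite wprodS IH; last exact: ltnW.
  rewrite -[in ext_w _ _](_ : val (Ordinal nm) = n)// ext_wE expabsE; last exact: wN.
  rewrite mxE [val _]/=; case Eb: (V n) => [b|]; last first.
    by rewrite (VN n n.+1) ?mulr0// leqnSn ltnS ltnW.
  rewrite expZbar_shift mulrA -[X in X * _]expRD -opprD -mulrDr -rmorphD subrr.
  by rewrite mulr0 oppr0 expR0 mul1r.
exists w; split => //.
  apply/rowP => k; rewrite mxE vE -VE; congr (_ - _).
  have := ltn_ord k; rewrite ltnS leq_eqVlt => /predU1P[->|km]; last exact: wV.
  by rewrite Vlast wprodS ext_w_out// mulr0.
move=> i j ij; rewrite !mxE => wi.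
have Vi : V i.+1 = None by case: (V i) (V i.+1) (VN i i.+1) wi => [b|] [] // _ ->//;
  rewrite leqnSn ltnS ltnW.
case: (V j) => // b; rewrite (VN i.+1 j.+1)//.
by rewrite ltnS ij ltnS ltnW.
Qed.

(** The vector x consists of differences of h / hbar. That w + x lies in Nbar comes from the target:
    it is the image of some [w'], whose entries are those of w + x wherever [w] is finite. *)
Lemma realize_surj c h : bs_arr m t hbar (c, h) -> exists z x w,
  [/\ sheu_arr m (z, x, w), cmap t hbar w = c & hmap hbar z x = h].
Proof.
move=> ch; have [w [wN wc wNone]] := cmap_surj (bs_srcP ch).
have [w' [w'N w'c _]] := cmap_surj (bs_tgtP ch).
rewrite /= in wc w'c; have [_ _ hZ _ hE] := ch.
have /choice[p pE] : forall k, exists a : int, h 0 k = hbar * a%:~R.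
  by move=> k; have [a _ <-] := hZ k; exists a.
pose P n : int := if n is n'.+1 then p (inord n') else 0.
have PE (k : 'I_m.+1) : P k.+1 = p k by rewrite /P inord_val.
pose x : 'rV[int]_m := \row_k (P k.+1 - P k); pose z : int := - P m.+1.
have sumx : \sum_j x 0 j = P m.
  rewrite (eq_bigr (fun j : 'I_m => P j.+1 - P j)); last by move=> j _; rewrite mxE.
  by rewrite -(big_mkord xpredT (fun j => P j.+1 - P j)) telescope_sumr// subr0.
have xP n : (n <= m.+1)%N -> xsum z x n = P n.
  elim: n => [|n IH] nm; first by rewrite /xsum big_ord0.
  rewrite xsumS IH; last exact: ltnW.
  move: nm; rewrite ltnS leq_eqVlt => /predU1P[->|nm].
    by rewrite /ext_x insubF ?ltnn//= sumx opprK subrKC.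
  by rewrite -[in ext_x _ _ _](_ : val (Ordinal nm) = n)// ext_xE mxE subrKC.
have hzx : hmap hbar z x = h.
  by apply/rowP => k; rewrite mxE xP// PE pE.
have qq n : (n <= m)%N -> qsum t hbar w' n = zshift (qsum t hbar w n) (P n).
  move=> nm; apply: (expZbar_inj hbar_gt0); rewrite expZbar_shift -!wprod_qsum//.
  case: n nm => [|n] nm; first by rewrite !wprod0 mulr0 oppr0 expR0 mul1r.
  have /rowP/(_ (Ordinal (leqW nm))) := w'c.
  rewrite -wc -hzx !mxE xP; last exact: leqW.
  lra.
exists z, x, w; split => //; split => //.
  move=> k; rewrite mxE; case wk : (w 0 k) => [a|]//.
  (* Because of the infinite tail, a finite entry has only finite entries before it. *)
  have [b qb] : exists b, qsum t hbar w k = Some b.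
    case E : (qsum t hbar w k) => [b|]; first by exists b.
    have : wprod t hbar w k = 0 by rewrite wprod_qsum// E.
    case/wprod_eq0 => j jk; rewrite -[j]/(val (Ordinal (ltn_trans jk (ltn_ord k)))).
    by rewrite ext_wE => wj; have := wNone (Ordinal _) k (ltnW jk) wj; rewrite wk.
  have qb' : qsum t hbar w' k = Some (b + P k) by rewrite qq ?qb// ltnW.
  have := w'N k; rewrite -ext_wE (qsum_shift qb') qq//= qb ext_wE wk /= mxE.
  by congr (is_true (_ <= _)); ring.
(* From the coordinate [i] on, c is 1 - t, so the last clause of [bs_arr] makes h constant there.
   This gives the conditions on z and on x together. *)
move=> i wi; have Plast n : (i < n <= m.+1)%N -> P n = P m.+1.
  move=> /andP[ni nm]; have [d dE] : exists d, d = (m.+1 - n)%N by exists (m.+1 - n)%N.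
  elim: d n dE ni nm => [|d IH] n dE ni nm.
    by congr P; apply/eqP; rewrite eqn_leq nm -subn_eq0 -dE.
  have nm' : (n < m.+1)%N by rewrite -subn_gt0 -dE.
  rewrite -(IH n.+1); [|by rewrite subnS -dE|exact: ltnW|by []].
  case: n ni {IH dE nm} nm' => // n; rewrite ltnS => ni nm'.
  have cE (k : 'I_m.+1) : (i <= k)%N -> c 0 k = 1 - t.
    by move=> ik; rewrite -wc; apply/cmap_eq; exists i; rewrite // ext_wE.
  have := hE (Ordinal (ltnW nm')) (Ordinal nm') erefl
    (cE (Ordinal _) ni) (cE (Ordinal _) (leqW ni)).
  by rewrite !pE -!PE => /(mulfI (lt0r_neq0 hbar_gt0))/eqP; rewrite eqr_int => /eqP.
split; first by rewrite sumx /z (Plast m)// ltn_ord leqnSn.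
move=> k ik; have km : (k < m.+1)%N by rewrite ltnW// ltnS.
by rewrite mxE (Plast k.+1) ?(Plast k) ?subrr// ?ik ?(ltnW km)// ltnS ltnW.
Qed.

End Bijection.

(** * The map induced on classes and the formula for Phi *)

Section Realization.
Context {R : realType}.
Variables (m : nat) (t hbar : R).
Hypothesis t_bounds : 0 < t < 1.
Hypothesis hbar_gt0 : 0 < hbar.

Implicit Types (w : 'rV[Zbar]_m) (x : 'rV[int]_m) (z : int).

Lemma realize_subproof (f : sheu_arr m) :
  bs_arr m t hbar (cmap t hbar (val f).2, hmap hbar (val f).1.1 (val f).1.2).
Proof.
apply: realize_bs_arr => //; rewrite -!surjective_pairing.
exact: set_mem (valP f).
Qed.

Definition realize (f : sheu_arr m) : bs_arr m t hbar :=
  exist _ (cmap t hbar (val f).2, hmap hbar (val f).1.1 (val f).1.2)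
    (mem_set (realize_subproof f)).

Lemma sheu_arr_src (f : sheu_arr m) : sheu_obj m (val f).2.
Proof. exact: sheu_srcP (set_mem (valP f)). Qed.

Lemma sheu_arr_tgt (f : sheu_arr m) : sheu_obj m (wadd (val f).2 (val f).1.2).
Proof. exact: sheu_tgtP (set_mem (valP f)). Qed.

Lemma realizeP (f f' : sheu_arr m) :
  realize f = realize f' <-> cls (@step_arr m) f = cls (@step_arr m) f'.
Proof.
rewrite cls_arrP; have A := cmap_agree t hbar_gt0 (sheu_arr_src f) (sheu_arr_src f').
split=> [/(congr1 val)[ce he]|[e ag]].
  have [ze xe] := hmap_inj hbar_gt0 he; split; last exact/A.
  by rewrite [LHS]surjective_pairing ze xe -surjective_pairing.
by apply: val_inj; rewrite /= e; congr (_, _); exact/A.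
Qed.

Lemma realize_surj_arr (g : bs_arr m t hbar) : exists f, realize f = g.
Proof.
have := set_mem (valP g); rewrite [val g]surjective_pairing.
move=> /(realize_surj t_bounds hbar_gt0)[z [x [w [zxw wc zxh]]]].
exists (exist _ (z, x, w) (mem_set zxw)); apply: val_inj => /=.
by rewrite wc zxh -surjective_pairing.
Qed.

Lemma realize_mul (f f' f'' : sheu_arr m) :
  sheu_mul f f' f'' -> bs_mul (realize f) (realize f') (realize f'').
Proof.
move=> [we fe]; split=> /=.
  by rewrite we gtarget_cmap//; [exact: sheu_arr_src|exact: sheu_arr_tgt].
rewrite fe /=; congr (_, _); apply/rowP => k; rewrite !mxE -mulrDr -rmorphD.
congr (_ * _%:~R); rewrite /xsum -big_split; apply: eq_bigr => j _.
rewrite /ext_x; case: insub => [i|]/=; first by rewrite mxE.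
rewrite (eq_bigr (fun i => (val f).1.2 0 i + (val f').1.2 0 i)).
  by rewrite big_split /=; ring.
by move=> i _; rewrite mxE.
Qed.

(** A sequence on [nat] that starts with the initial value absorbs the case distinction in
    [prev]. *)
Lemma prev_nat (A : Type) (V : nat -> A) (k : 'I_m) :
  Defs.prev (V 0%N) (fun i : 'I_m => V i.+1) k = V k.
Proof. by case: k => [[|k] km]. Qed.

(** This reads the formula for Phi off its inverse. An admissible [w] shares the entries of the
    representative while the preceding ones are finite, so [lift_src] makes it the source of an
    arrow of the same class. *)
Lemma realize_coords (f : sheu_arr m) :
  exists (p : 'rV[int]_m.+1) (q : 'rV[Zbar]_m),
    Phi_coords t hbar (val (realize f)) p q /\
    forall w : 'rV[Zbar]_m, Phi_w (q_t t hbar) q w ->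
      exists2 f' : sheu_arr m, val f' = (Phi_z p, Phi_x p, w)
        & cls (@step_arr m) f = cls (@step_arr m) f'.
Proof.
case Ef: (val f) => [[z x] w0]; have w0N := sheu_arr_src f; rewrite Ef /= in w0N.
pose q n := qsum t hbar w0 n; pose p n := xsum z x n.
exists (\row_k p k.+1), (\row_k q k.+1); split.
  by split=> k; rewrite /= Ef !mxE// wprod_qsum.
have pz : Phi_z (\row_(k < m.+1) p k.+1) = z.
  by rewrite /Phi_z mxE /p xsum_last opprK.
have px : Phi_x (\row_(k < m.+1) p k.+1) = x.
  apply/rowP => k; rewrite mxE mxE /= (_ : Defs.prev _ _ k = p k).
    by rewrite /p xsumS addrAC subrr add0r ext_xE.
  have p0 : p 0%N = 0 by exact: big_ord0.
  rewrite -[RHS]prev_nat p0; congr (Defs.prev _ _ _).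
  by apply/funext => i; rewrite mxE.
move=> w; rewrite pz px => wq.
have {}wq (k : 'I_m) : if q k is Some b then w 0 k = w0 0 k else Nbar (w 0 k).
  have := wq k; rewrite (_ : Defs.prev _ _ k = q k).
    case qk : (q k) => [b|]// ->; rewrite mxE -(ext_wE w0).
    exact: esym (qsum_shift qk).
  rewrite -[RHS]prev_nat; congr (Defs.prev _ _ _).
  by apply/funext => i; rewrite mxE.
have wN : sheu_obj m w.
  by move=> k; have := wq k; case: (q k) => // b ->; exact: w0N.
have ag : agree (val (exist _ w (mem_set wN) : sheu_obj m)) (val f).2.
  rewrite Ef /=; apply: agree_sym => k wk; have := wq k.
  case qk : (q k) => [b|]// _; have : wprod t hbar w0 k = 0.
    by rewrite wprod_qsum// -/(q k) qk.
  case/wprod_eq0 => j jk; rewrite -[j]/(val (Ordinal (ltn_trans jk (ltn_ord k)))).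
  by rewrite ext_wE => /wk; case.
have [f' [f'w ff']] := lift_src ag; exists f' => //.
have /cls_arrP[f'1 _] := ff'.
by rewrite [LHS]surjective_pairing f'w f'1 Ef.
Qed.

End Realization.

(** * Continuity in both directions *)

Section Topology.
Context {R : realType}.
Variables (m : nat) (t hbar : R).
Hypothesis t_bounds : 0 < t < 1.
Hypothesis hbar_gt0 : 0 < hbar.

Local Notation F := (@realize R m t hbar t_bounds hbar_gt0).
Implicit Types (w : 'rV[Zbar]_m) (x : 'rV[int]_m) (z : int).

Lemma cont_mul (S : topologicalType) (f g : S -> R) :
  continuous f -> continuous g -> continuous (fun s => f s * g s).
Proof. by move=> cf cg s; apply: cvgM; [exact: cf|exact: cg]. Qed.

Lemma cont_sub (S : topologicalType) (f g : S -> R) :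
  continuous f -> continuous g -> continuous (fun s => f s - g s).
Proof. by move=> cf cg s; apply: cvgB; [exact: cf|exact: cg]. Qed.

Lemma ext_w_cont j : continuous (fun w => ext_w w j).
Proof.
rewrite /ext_w; case: insub => [i|] /=; first exact: coord_cont.
exact: cst_continuous.
Qed.

Lemma wprod_cont n : continuous (fun w => wprod t hbar w n).
Proof.
elim: n => [|n IH].
  rewrite (_ : (fun w => _) = fun=> expR (- (hbar * (q_t t hbar)%:~R))).
    exact: cst_continuous.
  by apply/funext => w; rewrite wprod0.
rewrite (_ : (fun w => _) =
    (fun w => wprod t hbar w n * expabs hbar (ext_w w n))); last first.
  by apply/funext => w; rewrite wprodS.
apply: cont_mul; first exact: IH.
exact: (cont_comp (@ext_w_cont n) (expabs_cont hbar_gt0)).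
Qed.

Lemma cmap_cont : continuous (@cmap R m t hbar).
Proof.
apply: cont_mx => i j; rewrite (_ : i = 0) ?ord1//.
under eq_fun do rewrite mxE.
by apply: cont_sub; [exact: cst_continuous|exact: wprod_cont].
Qed.

Lemma realize_cont : continuous F.
Proof.
apply: sub_cont; apply: cont_pair.
  apply: cont_comp cmap_cont.
  exact: (cont_comp (@val_cont _ (sheu_arr m)) (@cont_snd _ _)).
move=> f U HU; have near_f := arr_zx_nbhs f.
apply: (nbhsS near_f) => f' /= ->; exact: nbhs_singleton HU.
Qed.

(** Two points of the lattice hbar Z at distance less than hbar coincide. *)
Lemma bs_arr_h_nbhs (g : bs_arr m t hbar) :
  nbhs g [set g' : bs_arr m t hbar | (val g').2 = (val g).2].
Proof.
have H (k : 'I_m.+1) :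
    nbhs g [set g' : bs_arr m t hbar | `|(val g').2 0 k - (val g).2 0 k| < hbar].
  have C : continuous (fun g' : bs_arr m t hbar => (val g').2 0 k).
    exact: (cont_comp (cont_comp (@val_cont _ _) (@cont_snd _ _))
      (@coord_cont _ _ _ 0 k)).
  have B : nbhs ((val g).2 0 k) [set r : R | `|r - (val g).2 0 k| < hbar].
    exists hbar => //= r; rewrite /ball_/= distrC; exact.
  exact: C B.
apply: (nbhsS (nbhs_forall H)) => g' /= gg'.
have hZ (g1 : bs_arr m t hbar) k : hbarZ hbar ((val g1).2 0 k).
  by have := set_mem (valP g1); case: (val g1) => c h [].
apply/rowP => k; have [a _ ea] := hZ g' k; have [b _ eb] := hZ g k.
have := gg' k; rewrite -ea -eb -mulrBr normrM gtr0_norm//.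
rewrite gtr_pMr// -rmorphB -intr_norm -[1]/(1%:~R) ltr_int => ab.
congr (_ * _%:~R); lia.
Qed.

(** Zbar is compact, and the complement of this set is open because it consists of finite, hence
    isolated, points. *)
Lemma Nbar_shift_compact (a : int) :
  compact ([set v | Nbar v /\ Nbar (zshift v a)] : set Zbar).
Proof.
apply: (subclosed_compact _ (@one_point_compactification_compact int)) => //.
rewrite -[X in closed X]setCK; apply: open_closedC.
rewrite openE => -[b|] nb; last by exfalso; exact: nb.
by apply: (@nbhsS Zbar (Some b) _ _ (@Zbar_nbhs_Some b)) => _ ->.
Qed.

(* The third condition defining sheu_arr is not closed, hence its absence. *)
Definition shiftable x : set 'rV[Zbar]_m :=
  [set w | forall i, Nbar (w 0 i) /\ Nbar (zshift (w 0 i) (x 0 i))].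

Lemma shiftable_compact x : compact (shiftable x).
Proof. exact: rV_compact (fun i => @Nbar_shift_compact (x 0 i)). Qed.

(** Finite entries are isolated, so a nearby [w] is infinite only where the source of [f] is, and it
    inherits the third condition of [sheu_arr] from [f]. *)
Lemma near_lift (U : set (fq_arr m)) z x (f : sheu_arr m) :
  open U -> U (cls _ f) -> (val f).1 = (z, x) ->
  \forall w \near (val f).2, shiftable x w ->
    exists2 f' : sheu_arr m, val f' = (z, x, w) & U (cls _ f').
Proof.
move=> oU Uf fzx.
have [_ [[N oN <-] /= Nf] NU] :=
  @cls_cont _ (@step_arr m) f U (open_nbhs_nbhs (conj oU Uf)).
have HN : nbhs (val f).2 [set w | N (z, x, w)].
  have C : continuous (fun w => (z, x, w)).
    by apply: cont_pair; [exact: cst_continuous|move=> w; exact: cvg_id].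
  apply: (C (val f).2); apply: open_nbhs_nbhs; split => //.
  by rewrite -fzx -surjective_pairing.
have Hinf (i : 'I_m) :
    nbhs (val f).2 [set w | w 0 i = None -> (val f).2 0 i = None].
  case E : ((val f).2 0 i) => [a|]; last exact: (nbhsS (@filterT _ _ _)).
  have Ha : nbhs ((val f).2 0 i) [set (Some a : Zbar)].
    by rewrite E; exact: Zbar_nbhs_Some.
  by apply: (nbhsS (@coord_cont _ 1 m 0 i (val f).2 _ Ha)) => w /= ->.
apply: (nbhsS (nbhsI HN (nbhs_forall Hinf))) => w [Nw winf] wx.
have fP : sheu_arr m (z, x, (val f).2).
  by rewrite -fzx -surjective_pairing; exact: set_mem (valP f).
have wP : sheu_arr m (z, x, w).
  split=> [i|i|i wi]; first by have [] := wx i.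
    by rewrite mxE; have [] := wx i.
  by have [_ _ H] := fP; exact/H/winf.
by exists (exist _ (z, x, w) (mem_set wP)) => //; exact: NU.
Qed.

(** This is continuity of the inverse at [F f], by a tube argument: the claim is checked near each
    point of the compact set [shiftable x], for c near the image of [w]. *)
Lemma near_realize (U : set (fq_arr m)) (f : sheu_arr m) :
  open U -> U (cls _ f) ->
  \forall g \near F f, forall f' : sheu_arr m, F f' = g -> U (cls _ f').
Proof.
move=> oU Uf; case Ef: (val f) => [[z x] w].
pose good w' := exists2 f' : sheu_arr m, val f' = (z, x, w') & U (cls _ f').
have fP := set_mem (valP f); rewrite [val f]Ef in fP.
have K : \forall c \near cmap t hbar w, forall w', shiftable x w' ->
    cmap t hbar w' = c -> good w'.
  have /compact_near_coveringP/near_covering_withinP cov := @shiftable_compact x.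
  apply: (cov _ _ (fun c w' => cmap t hbar w' = c -> good w')
    (nbhs_filter (cmap t hbar w))) => w' w'x.
  (* If [w'] has the image of [w], it is the source of an arrow in the class of [f], and [near_lift]
     applies. Otherwise the images differ in a coordinate, still do so nearby, and the implication
     is vacuous. *)
  have [e|/eqP ne] := pselect (cmap t hbar w' = cmap t hbar w).
    have w'N : sheu_obj m w' by move=> i; have [] := w'x i.
    have wN : sheu_obj m w by case: fP.
    have /(cmap_agree t hbar_gt0 w'N wN) ag := e.
    have [|f' [f'w /[dup] ff' /cls_arrP[f'1 _]]] :=
      @lift_src m (exist _ w' (mem_set w'N)) f; first by rewrite Ef.
    rewrite /= in f'w; have := @near_lift U z x f' oU.
    rewrite ff' f'1 Ef f'w => /(_ Uf erefl) G.
    exists ([set w'' | shiftable x w'' -> good w''], setT).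
      by split; [exact: G|exact: filterT].
    by move=> [w'' c] /= [H _] wx _; exact: H.
  have [k nek] : exists k, cmap t hbar w' 0 k - cmap t hbar w 0 k != 0.
    apply/not_existsP => H; move/eqP: ne; apply; apply/rowP => k.
    by apply/eqP; rewrite -subr_eq0; apply/negPn/negP/H.
  pose D (wc : 'rV[Zbar]_m * 'rV[R]_m.+1) : R := cmap t hbar wc.1 0 k - wc.2 0 k.
  have C : continuous D.
    apply: cont_sub.
      exact: (cont_comp (cont_comp (@cont_fst _ _) cmap_cont) (@coord_cont _ _ _ 0 k)).
    exact: (cont_comp (@cont_snd _ _) (@coord_cont _ _ _ 0 k)).
  have nD : nbhs (D (w', cmap t hbar w)) [set r : R | r != 0].
    by apply: open_nbhs_nbhs; split => //; exact: open_neq.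
  apply: (nbhsS (C _ _ nD)) => -[w'' c] /= D0 _ e.
  by move: D0; rewrite /D /= e subrr eqxx.
have C : continuous (fun g : bs_arr m t hbar => (val g).1).
  exact: (cont_comp (@val_cont _ _) (@cont_fst _ _)).
have K' : nbhs (F f)
    [set g | forall w', shiftable x w' -> cmap t hbar w' = (val g).1 -> good w'].
  have := C (F f) _; rewrite /continuous_at /= Ef => C'; exact: (C' _ K).
(* As h is locally constant, all preimages of a nearby arrow have the z and x of [f]. *)
apply: (nbhsS (nbhsI K' (bs_arr_h_nbhs (F f)))).
move=> g [gK gh] f' f'g; have : hmap hbar (val f').1.1 (val f').1.2 = hmap hbar z x.
  by move: gh; rewrite -f'g /= Ef.
move=> /(hmap_inj hbar_gt0)[z' x'].
have [|| f'' f''e Uf''] := gK (val f').2; last 2 first.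
- by rewrite -f'g.
- by rewrite (_ : f' = f'')//; apply: val_inj;
    rewrite f''e [LHS]surjective_pairing [(val f').1]surjective_pairing z' x'.
by move=> i; have := sheu_arr_src f' i; have := sheu_arr_tgt f' i; rewrite mxE x'.
Qed.

End Topology.

Theorem proposition7p3 (R : realType) (m : nat) (t hbar : R)
    (t_bounds : 0 < t < 1) (hbar_gt0 : 0 < hbar) :
  exists Phi : garr (bs_groupoid m t hbar) -> garr (sheu_groupoid m),
    (forall g : bs_arr m t hbar,
       exists (p : 'rV[int]_m.+1) (q : 'rV[Zbar]_m),
         Phi_coords t hbar (val g) p q /\
         forall w : 'rV[Zbar]_m, Phi_w (q_t t hbar) q w ->
           exists2 f : sheu_arr m,
             val f = (Phi_z p, Phi_x p, w) & Phi g = cls (@step_arr m) f) /\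
    topGroupoid_iso Phi.
Proof.
pose F := @realize R m t hbar t_bounds hbar_gt0.
(* A preimage is chosen for each arrow; by [realizeP] its class does not depend on the choice. *)
have /choice[s sK] : forall g, exists f, F f = g.
  exact: realize_surj_arr.
pose Phi (g : bs_arr m t hbar) : fq_arr m := cls _ (s g).
have PhiF f : Phi (F f) = cls _ f by apply/(realizeP t_bounds hbar_gt0); exact: sK.
exists Phi; split.
  by move=> g; have := realize_coords t_bounds hbar_gt0 (s g); rewrite -/F sK.
apply: topGroupoid_iso_of_arrows.
  split.
    apply/continuousP => U oU; rewrite openE => g Ug.
    have := near_realize t_bounds hbar_gt0 oU Ug; rewrite -/F sK.
    by apply: filterS => g' H; apply: H; exact: sK.
  pose Psi (A : fq_arr m) := F (clsrepr A).
  have PsiE f : Psi (cls _ f) = F f.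
    by apply/(realizeP t_bounds hbar_gt0); exact: clsreprK.
  exists Psi; split.
  - apply: gen_quot_continuous; rewrite (_ : (fun a => _) = F).
      exact: realize_cont.
    by apply/funext => f; exact: PsiE.
  - by move=> g; rewrite PsiE sK.
  - by move=> A; rewrite PhiF clsreprK.
move=> a b c [be ce]; rewrite /= /Phi.
(* Composability of [a] and [b] only makes the target of [s a] and the source of [s b] agree, so
   [s b] is replaced by an equivalent [b'] that starts at this target. *)
have ag : agree (wadd (val (s a)).2 (val (s a)).1.2) (val (s b)).2.
  have : (val (F (s b))).1 = gtarget t (val (F (s a))).1 (val (F (s a))).2.
    by rewrite !sK.
  have [aN axN bN] :=
    And3 (sheu_arr_src (s a)) (sheu_arr_tgt (s a)) (sheu_arr_src (s b)).
  by rewrite /= gtarget_cmap// => /(cmap_agree t hbar_gt0 bN axN)/agree_sym.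
have [b' [b'w b'b]] := @lift_src m (sheu_tgt (s a)) (s b) ag.
have [c' c'm] := sheu_mul_ex b'w.
exists (s a), b', c'; split => //.
have abc : bs_mul a b (F c').
  have <- : F (s a) = a by exact: sK.
  have <- : F b' = b by rewrite -[RHS]sK; apply/(realizeP t_bounds hbar_gt0).
  exact: realize_mul.
apply/(realizeP t_bounds hbar_gt0); rewrite -/F sK.
exact: bs_mul_uniq abc (conj be ce).
Qed.
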